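(* Let $f:\mathbb{R}^n\to\mathbb{R}$ be a Lipschitz function. If $x_*\in\mathbb{R}^n$ is an optimal point (a minimum point or a maximum point) of $f$ on $\mathbb{R}^n$, then $0\in Df(x_* )$.
   Context: $\nabla f$ denotes the gradient, $\mathrm{co}$ the convex hull. Let $x_0\in\mathbb{R}^n$. The set $\eta(x_0)$ is the set of smooth curves $r(x_0,\alpha,g)=x_0+\alpha g+o_r(\alpha)$, where $g\in S^{n-1}_1(0)=\{v\in\mathbb{R}^n:\|v\|=1\}$ and the function $o_r:[0,\alpha_0]\to\mathbb{R}^n$, $\alpha_0>0$, satisfies: (1) $o_r(\alpha)/\alpha\to 0$ as $\alpha\to+0$, uniformly in $r$; (2) the derivative $o_r'$ exists and is continuous, and there is $c<\infty$ such that $\sup_{\tau\in(0,\alpha_0)}\|o_r'(\tau)\|\le c$ for all $r$; (3) the gradient $\nabla f(r(x_0,\cdot,g))$ exists almost everywhere along the curve. $Ef(x_0)$ is the set of all $v\in\mathbb{R}^n$ for which there exist a sequence $\alpha_k\to+0$, a $g\in S^{n-1}_1(0)$ and a curve $r(x_0,\cdot,g)\in\eta(x_0)$ with $v=\lim_{\alpha_k\to+0}\alpha_k^{-1}\int_0^{\alpha_k}\nabla f(r(x_0,\tau,g))\,d\tau$ (Lebesgue integral), and $Df(x_0)=\mathrm{co}\,Ef(x_0)$. *)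

(* Defs.v *)
From mathcomp Require Import all_boot all_order all_algebra.
From mathcomp Require Import all_classical all_reals all_analysis.
Import Order.TTheory GRing.Theory Num.Theory.
Import numFieldNormedType.Exports.

Set Implicit Arguments.
Unset Strict Implicit.
Unset Printing Implicit Defensive.

Local Open Scope classical_set_scope.
Local Open Scope ring_scope.

(* The Euclidean norm on R^n; the library norm `|v| on row vectors is the sup
   norm, which defines the same topology but a different unit sphere. *)
Definition enorm {R : realType} {n : nat} (v : 'rV[R]_n) : R :=
  Num.sqrt (\sum_(i < n) v ord0 i ^+ 2).

Definition lipschitz_function {R : realType} {n : nat} (f : 'rV[R]_n -> R) :=
  exists L : R, forall x y, `|f x - f y| <= L * enorm (x - y).

(* Meaningful where f is (Frechet) differentiable. *)
Definition gradient {R : realType} {n : nat} (f : 'rV[R]_n -> R)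
    (x : 'rV[R]_n) : 'rV[R]_n :=
  \row_(i < n) 'D_(delta_mx ord0 i) f x.

(* h' is the derivative of h at each point of [a, b], one-sided at the
   endpoints; values of h outside [a, b] play no role. *)
Definition derivative_on {R : realType} {n : nat} (a b : R)
    (h h' : R -> 'rV[R]_n) : Prop :=
  forall t : R, t \in `[a, b] ->
    (s - t)^-1 *: (h s - h t) @[s --> within `[a, b]%classic t^'] --> h' t.

Definition curve {R : realType} {n : nat} (x0 g : 'rV[R]_n)
    (o : R -> 'rV[R]_n) (t : R) : 'rV[R]_n :=
  x0 + t *: g + o t.

(* A curve x0 + t g + o(t) is encoded by the pair (g, o), with o relevant on
   [0, a0] only.  The conditions on the remainders are uniform over a family H
   of curves: the modulus d and the constant c depend on H, not on its
   members. *)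
Record admissible {R : realType} {n : nat} (f : 'rV[R]_n -> R)
    (x0 : 'rV[R]_n) (a0 : R) (H : set ('rV[R]_n * (R -> 'rV[R]_n))) : Prop :=
  Admissible {
    adm_gt0 : 0 < a0;
    adm_unit : forall g o, H (g, o) -> enorm g = 1;
    adm_small : forall e : R, 0 < e -> exists2 d : R, 0 < d &
      forall g o, H (g, o) ->
      forall t : R, 0 < t -> t < d -> t <= a0 -> enorm (t^-1 *: o t) <= e;
    adm_deriv : exists c : R, forall g o, H (g, o) ->
      exists o' : R -> 'rV[R]_n,
        [/\ derivative_on 0 a0 o o',
            {within `[0, a0], continuous o'}
          & forall t : R, t \in `]0, a0[ -> enorm (o' t) <= c];
    adm_grad : forall g o, H (g, o) ->
      {ae lebesgue_measure, forall t : R, t \in `[0, a0] ->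
        differentiable f (curve x0 g o t)}
  }.

(* No largest admissible family exists, as the uniform bounds are not
   prescribed; a curve belongs to eta when some admissible family has it. *)
Definition eta {R : realType} {n : nat} (f : 'rV[R]_n -> R) (x0 : 'rV[R]_n) :
    set ('rV[R]_n * (R -> 'rV[R]_n)) :=
  [set r | exists a0 H, admissible f x0 a0 H /\ H r].

Definition gradient_integral {R : realType} {n : nat} (f : 'rV[R]_n -> R)
    (r : R -> 'rV[R]_n) (a : R) : 'rV[R]_n :=
  \row_(i < n) (\int[lebesgue_measure]_(t in `[0, a]) gradient f (r t) ord0 i).

Definition Ef {R : realType} {n : nat} (f : 'rV[R]_n -> R) (x0 : 'rV[R]_n) :
    set 'rV[R]_n :=
  [set v | exists (a : nat -> R) (g : 'rV[R]_n) (o : R -> 'rV[R]_n),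
    [/\ eta f x0 (g, o),
        forall k, 0 < a k,
        a k @[k --> \oo] --> (0 : R)
      & (a k)^-1 *: gradient_integral f (curve x0 g o) (a k) @[k --> \oo]
          --> v]].

Definition convex_hull {R : realType} {n : nat} (A : set 'rV[R]_n) :
    set 'rV[R]_n :=
  smallest (@convex_set R 'rV[R]_n) A.

Definition Df {R : realType} {n : nat} (f : 'rV[R]_n -> R) (x0 : 'rV[R]_n) :
    set 'rV[R]_n :=
  convex_hull (Ef f x0).

Definition optimal_point {R : realType} {n : nat} (f : 'rV[R]_n -> R)
    (x : 'rV[R]_n) : Prop :=
  (forall y, f x <= f y) \/ (forall y, f y <= f x).

(* Main.v *)
From HB Require Import structures.
Require Import Defs.
From mathcomp Require Import all_boot all_order all_algebra.
From mathcomp Require Import all_classical all_reals all_analysis.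
From mathcomp Require Import measurable_realfun ring lra.
Import Order.TTheory GRing.Theory Num.Theory.
Import numFieldNormedType.Exports.
Set Implicit Arguments.
Unset Strict Implicit.
Local Open Scope classical_set_scope.
Local Open Scope ring_scope.

(* For rational vectors h, the averages A_h(a) of the gradient over [0, a] along
   x + t h + t^2 y satisfy, by the fundamental theorem of calculus, <A_h(a), h>
   = (f(x + a h + a^2 y) - f x) / a + O(a), so at a minimum every limit v of
   A_h(a), as a -> 0 and h -> g, has <v, g> >= 0.  The set K of the limits v
   with |g| = 1 is compact, so 0 is in its convex hull: otherwise the point of
   the hull nearest to 0 would be separated from K.  A maximum is treated by
   changing signs.

   It remains to see that K is contained in Ef f x.  A limit v belongs to scales
   a_k and directions h_k -> g; following direction h_k on [b_k, a_k] with
   b_k << a_k, and turning smoothly from h_(k+1) to h_k on [a_(k+1), b_k], gives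
   one curve tangent to g whose averages on [0, a_k] tend to v.

   All these curves are made of countably many pieces, and for a generic y the
   perturbation t^2 y makes f differentiable almost everywhere along each of them.
   Indeed (Aronszajn) the points where f is not differentiable form n sets, the
   k-th one null on every line parallel to the k-th axis; by Fubini, c(t) + t^2 y
   almost surely meets none of them, for y uniform in a cube and almost every t. *)

(** * Lipschitz functions of one real variable *)

(** Rademacher's theorem alone would not do: its exceptional null set of [R^n] may contain a whole
    curve, hence the finer splitting into sets that are null on parallel lines. One vector [y] has
    to serve all curves at once and can be generic for countably many only; this is why the
    directions [h_k] are rational and the turning scales [b_k] are inverses of integers. The
    perturbation [t^2 y] is [o(t)], so it leaves the tangent at 0 unchanged, while its factor [t^2]
    is nonzero for [t > 0], which is what genericity at time [t] needs.

    A limit with direction [g] is reached through varying directions, whereas [Ef] asks for a single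
    curve; this gap is what the patching closes. Fixing one direction instead would lose the
    compactness of [K] under changes of [g], and the hull of a non-compact set may fail to contain
    its nearest point to 0.

    The fundamental theorem of calculus for an [L]-Lipschitz [F] comes from the theorem of
    Radon-Nikodym, applied to the Stieltjes measure of [F t + L t], which is at most [2 L] times
    Lebesgue measure. *)

Section lipschitz_line.
Context {R : realType}.
Notation mu := (@lebesgue_measure R).

Lemma wlength_le (G : cumulative R R) (c : R) (A : set (ocitv_type R)) : 0 <= c ->
  (forall x y, x <= y -> G y - G x <= c * (y - x)) ->
  ocitv A -> (wlength G A <= c%:E * wlength idfun A)%E.
Proof.
move=> c0 Gc /ocitvP[->|[[x y] /= xy ->]].
  by rewrite !wlength0 mule0.
by rewrite !wlength_itv_bnd ?(ltW xy)//= -EFinM lee_fin Gc// ltW.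
Qed.

(** Both sides are infima over coverings by half-open intervals, so the comparison of interval
    lengths passes to them; measurability of [A] does not enter. *)
Lemma stieltjes_le_lebesgue (G : cumulative R R) (c : R) (A : set (measurableTypeR R)) :
  0 < c -> (forall x y, x <= y -> G y - G x <= c * (y - x)) ->
  (lebesgue_stieltjes_measure G A <= c%:E * mu A)%E.
Proof.
move=> c0 Gc; rewrite -lee_pdivrMl//.
rewrite [leRHS]/lebesgue_measure /lebesgue_stieltjes_measure /measure_extension /=.
apply: le_ereal_inf_tmp => _ [B [mB AB] <-].
rewrite lee_pdivrMl//.
apply: (@le_trans _ _ (\sum_(k <oo) wlength G (B k))%E).
  by apply: ereal_inf_lbound; exists B.
rewrite -nneseriesZl//.
apply: lee_nneseries => [k _ _|k _]; first exact: measure_ge0.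
by apply: (wlength_le (ltW c0) Gc); exact: mB.
Qed.

(** The function [F x + L x] is nondecreasing and its Stieltjes measure has a density [psi]; then
    [phi = psi - L]. Lebesgue differentiation of the integral of [psi] gives the derivative, so
    differentiability and the integral formula have the same source. *)
Lemma lipschitz_density (F : R -> R) (L : R) :
  (forall x y, `|F x - F y| <= L * `|x - y|) ->
  exists phi : R -> R, [/\ mu.-integrable `[0, 1] (EFin \o phi),
   {ae mu, forall x : R, 0 < x < 1 -> is_derive x (1 : R) F (phi x)} &
   forall a, 0 <= a -> a <= 1 -> \int[mu]_(t in `[0, a]) phi t = F a - F 0].
Proof.
move=> FL0.
have {FL0} [{}L L0 FL] : exists2 K : R, 0 < K & forall x y, `|F x - F y| <= K * `|x - y|.
  exists (`|L| + 1); first by rewrite ltr_wpDl.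
  move=> x y; apply: le_trans (FL0 x y) _; apply: ler_wpM2r => //.
  by rewrite (le_trans (ler_norm _))// lerDl.
pose G x := F x + L * x.
have Fle x y : x <= y -> `|F y - F x| <= L * (y - x).
  by move=> xy; have := FL y x; rewrite [`|y - x|]ger0_norm// subr_ge0.
have Gnd : nondecreasing G.
  move=> x y xy; rewrite /G; have := Fle _ _ xy; rewrite ler_norml => /andP[h _].
  by lra.
have Fc : continuous F.
  move=> x; apply/cvgrPdist_le => e e0; near=> t.
  apply: (le_trans (FL _ _)); rewrite -ler_pdivlMl//.
  by near: t; apply: cvgr_dist_le => //; rewrite mulr_gt0// invr_gt0.
have Gc : continuous G.
  by move=> x; apply: cvgD; [exact: Fc | apply: cvgM; [exact: cvg_cst | exact: cvg_id]].
pose Gm := isCumulative.Build R _ R G Gnd (right_continuousW Gc).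
pose GG : cumulative R R := HB.pack G Gm.
have Gl : forall x y, x <= y -> GG y - GG x <= (2 * L) * (y - x).
  move=> x y xy; have := Fle _ _ xy; rewrite ler_norml => /andP[_ h].
  by rewrite /GG /= /G; lra.
pose nu := lebesgue_stieltjes_measure GG.
have L20 : 0 < 2 * L by rewrite mulr_gt0.
have nule A : (nu A <= (2 * L)%:E * mu A)%E by exact: stieltjes_le_lebesgue.
have nuitv a b : a <= b -> nu `]a, b]%classic = (GG b - GG a)%:E.
  move=> ab; rewrite -(wlength_itv_bnd GG false false ab).
  by apply: measurable_mu_extE; exact: is_ocitv.
have mD : measurable (`]0, 1]%classic : set (measurableTypeR R)) by exact: measurable_itv.
have nuD : (nu (`]0%R, 1%R]%classic : set R) < +oo)%E by rewrite nuitv ?ler01// ltry.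
(* Restricting to []0, 1]] makes the measure finite, as needed for Radon-Nikodym. *)
pose nu1 : {finite_measure set (measurableTypeR R) -> \bar R} := mfrestr mD nuD.
have numu : nu1 `<< mu.
  apply/null_content_dominatesP => A mA A0.
  apply/eqP; rewrite eq_le measure_ge0 andbT.
  apply: (le_trans (nule _)); rewrite -(mule0 (2 * L)%:E) lee_pmul2l// -A0 le_measure ?inE//.
  exact: measurableI.
have [f [f0 ffin fint fE]] := radon_nikodym_sigma_finite numu.
pose psi := fine \o f.
have psiE : EFin \o psi = f by apply/funext => x; rewrite /= fineK.
have psint : mu.-integrable setT (EFin \o psi) by rewrite psiE.
have psiD a : 0 <= a -> a <= 1 -> \int[mu]_(t in `]0, a]) psi t = G a - G 0.
  move=> a0 a1; rewrite /Rintegral.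
  rewrite (_ : integral _ _ _ = nu1 `]0, a]%classic).
    rewrite /nu1 /= /mfrestr /mrestr.
    have -> : (`]0, a] `&` `]0, 1] = `]0, a] :> set R)%classic.
      apply/seteqP; split => x /=; rewrite !in_itv/=; first by case.
      by move=> /andP[-> xa]; split => //; rewrite (le_trans xa).
    by rewrite [lebesgue_stieltjes_measure _ _]nuitv.
  by rewrite fE; [rewrite -psiE|exact: measurable_itv].
have intS (A : set R) : measurable A -> mu.-integrable A (EFin \o psi).
  by move=> mA; apply: integrableS psint.
have intL a : mu.-integrable `[0, a] (EFin \o cst L).
  apply: measurable_bounded_integrable => //=.
  - by rewrite lebesgue_measure_itv/=; case: ifP => _; rewrite ?ltry.
  - by exists `|L|; split => // M LM x _ /=; rewrite ltW.
exists (fun x => psi x - L); split.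
- have : mu.-integrable `[0, 1] ((EFin \o psi) \- (EFin \o cst L))%E.
    by apply: integrableB => //; exact: intS.
  by [].
- have := @FTC1 R psi (BRight 0) (fun y => intS _ (measurable_itv _)) (open_integrable_locally openT psint).
  apply: filterS; first exact: (ae_filter_ringOfSetsType mu).
  move=> x /= h /andP[x0 x1].
  have [dh h'] := h x0.
  have nearF : \forall y \near x, F y = (\int[mu]_(t in `]0, y]) psi t) - L * y + F 0.
    near=> y; rewrite psiD.
    + by rewrite /G; ring.
    + by apply/ltW; near: y; exact: lt_nbhsr.
    + by apply/ltW; near: y; exact: lt_nbhsl.
  have dI : is_derive x 1 (fun y => (\int[mu]_(t in `]0, y]) psi t) - L * y + F 0) (psi x - L).
    have -> : psi x - L = psi x - L * 1 + 0 by ring.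
    apply: is_deriveD; apply: is_deriveB; first by apply: DeriveDef => //; rewrite -derive1E.
  apply: (near_eq_is_derive _ dI).
  by apply: filterS nearF => y ->.
- move=> a a0 a1.
  rewrite RintegralB//; last exact: intS.
  rewrite -Rintegral_itv_obnd_cbnd; last exact: intS.
  have mua : fine (mu (`[0, a]%classic : set R)) = a.
    by rewrite lebesgue_measure_itv/= lte_fin; move: a0; rewrite le_eqVlt => /predU1P[<-|->]; rewrite ?ltxx//=
      oppr0 addr0.
  rewrite psiD// Rintegral_cst//.
  transitivity (G a - G 0 - L * a); first by congr (_ - _ * _); exact: mua.
  by rewrite /G; ring.
Unshelve. all: by end_near. Qed.

End lipschitz_line.

(** * The scalar product *)

Definition dot {R : realType} {n : nat} (u v : 'rV[R]_n) : R :=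
  \sum_(i < n) u ord0 i * v ord0 i.

Section norm_limits.
Context {R : realType} {V W : normedModType R}.

Lemma near_norm_le (x : V) (d : R) : 0 < d -> \forall t \near x, `|x - t| <= d.
Proof. by move=> d0; apply/nbhs_normP; exists d => // t /ltW. Qed.

Lemma lipschitz_continuous (f : V -> W) (c : R) :
  (forall x y, `|f x - f y| <= c * `|x - y|) -> continuous f.
Proof.
move=> fc x; apply/cvgrPdist_le => e e0; near=> t.
have c0 : 0 < `|c| + 1 by rewrite ltr_wpDl.
apply: (le_trans (fc _ _)); apply: (@le_trans _ _ ((`|c| + 1) * `|x - t|)).
  by rewrite ler_wpM2r// (le_trans (ler_norm _))// lerDl.
by rewrite -ler_pdivlMl//; near: t; apply: near_norm_le; rewrite mulr_gt0 ?invr_gt0.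
Unshelve. all: by end_near. Qed.

Lemma differentiable_eps (f : V -> W) (df : {linear V -> W}) (x : V) :
  continuous df ->
  (forall e : R, 0 < e -> exists2 d : R, 0 < d & forall w, `|w| <= d ->
    `|f (x + w) - f x - df w| <= e * `|w|) ->
  differentiable f x.
Proof.
move=> cdf fdf.
have fE : f \o shift x = cst (f x) + df +o_ 0 id.
  apply/eqaddoP => e e0; have [d d0 fd] := fdf _ e0.
  near=> w; rewrite /= !fctE /= opprD addrA (addrC w); apply: fd.
  by rewrite -[w]subr0 -normrN opprB; near: w; exact: near_norm_le.
by apply/diff_locallyP; rewrite (diff_unique cdf fE).
Unshelve. all: by end_near. Qed.

End norm_limits.

Lemma near_real_le {R : realType} (x d : R) : 0 < d -> \forall t \near x, `|x - t| <= d.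
Proof. by move=> d0; exact: (@near_norm_le R R x d d0). Qed.

Section row_vectors.
Context {R : realType} {n : nat}.
Implicit Types (u v w : 'rV[R]_n) (c : R).

Lemma coord_le_norm v i : `|v ord0 i| <= `|v|.
Proof.
rewrite [leRHS]/Num.norm /= mx_normrE.
by apply: (@le_bigmax _ _ _ 0 (fun ij : 'I_1 * 'I_n => `|v ij.1 ij.2|) (ord0, i)).
Qed.

Lemma norm_row_le v c : 0 <= c -> (forall i, `|v ord0 i| <= c) -> `|v| <= c.
Proof.
move=> c0 vc; rewrite [leLHS]/Num.norm /= mx_normrE.
by apply/bigmax_leP; split=> // -[j i] _ /=; rewrite ord1.
Qed.

Lemma dotDl u v w : dot (u + v) w = dot u w + dot v w.
Proof. by rewrite /dot -big_split; apply: eq_bigr => i _; rewrite mxE mulrDl. Qed.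

Lemma dotC u v : dot u v = dot v u.
Proof. by apply: eq_bigr => i _; rewrite mulrC. Qed.

Lemma dotZl c u v : dot (c *: u) v = c * dot u v.
Proof. by rewrite /dot mulr_sumr; apply: eq_bigr => i _; rewrite mxE mulrA. Qed.

Lemma dotDr u v w : dot u (v + w) = dot u v + dot u w.
Proof. by rewrite dotC dotDl !(dotC u). Qed.

Lemma dotZr c u v : dot u (c *: v) = c * dot u v.
Proof. by rewrite dotC dotZl dotC. Qed.

Lemma dotNl u v : dot (- u) v = - dot u v.
Proof. by rewrite -scaleN1r dotZl mulN1r. Qed.

Lemma dotNr u v : dot u (- v) = - dot u v.
Proof. by rewrite dotC dotNl dotC. Qed.

Lemma dot0l v : dot 0 v = 0.
Proof. by rewrite -[0](scale0r v) dotZl mul0r. Qed.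

Lemma dot0r v : dot v 0 = 0.
Proof. by rewrite dotC dot0l. Qed.

Lemma dot_delta u i : dot u (delta_mx ord0 i) = u ord0 i.
Proof.
rewrite /dot (bigD1 i)//= mxE !eqxx mulr1 big1 ?addr0// => j ji.
by rewrite mxE (negbTE ji) andbF mulr0.
Qed.

Lemma dot_bound u v c : (forall i, `|u ord0 i| * `|v ord0 i| <= c * `|v|) ->
  `|dot u v| <= n%:R * c * `|v|.
Proof.
move=> h; apply: (le_trans (ler_norm_sum _ _ _)).
apply: (@le_trans _ _ (\sum_(i < n) c * `|v|)).
  by apply: ler_sum => i _; rewrite normrM.
by rewrite sumr_const card_ord -[leLHS]mulr_natl mulrA.
Qed.

Lemma dot_le u v : `|dot u v| <= n%:R * `|u| * `|v|.
Proof.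
by apply: dot_bound => i; apply: ler_pM => //; exact: coord_le_norm.
Qed.

Lemma norm_delta (i : 'I_n) : `|delta_mx ord0 i : 'rV[R]_n| = 1.
Proof.
apply/eqP; rewrite eq_le; apply/andP; split.
  apply: norm_row_le => // j; rewrite mxE; case: (_ && _); rewrite ?normr1//.
  by rewrite normr0.
by have := coord_le_norm (delta_mx ord0 i) i; rewrite mxE !eqxx normr1.
Qed.

Lemma dot_continuous u : continuous (dot u).
Proof.
apply: (@lipschitz_continuous _ _ _ _ (n%:R * `|u|)) => v w.
by rewrite -dotNr -dotDr dot_le.
Qed.

Lemma dot_linear u : linear (dot u : 'rV[R]_n -> R).
Proof. by move=> k v w; rewrite dotDr dotZr. Qed.

Lemma differentiable_dot (f : 'rV[R]_n -> R) x p :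
  (forall e, 0 < e -> exists2 d, 0 < d & forall w, `|w| <= d ->
    `|f (x + w) - f x - dot p w| <= e * `|w|) ->
  differentiable f x.
Proof.
move=> fp.
pose dpm := GRing.isLinear.Build R 'rV[R]_n R _ (dot p) (dot_linear p).
pose dp : {linear 'rV[R]_n -> R} := HB.pack (dot p) dpm.
by apply: (@differentiable_eps _ _ _ f dp x) => //; exact: dot_continuous.
Qed.

Lemma gradientE (f : 'rV[R]_n -> R) x v : differentiable f x ->
  'D_v f x = dot (gradient f x) v.
Proof.
move=> df; rewrite deriveE// {1}(row_sum_delta v) linear_sum /dot.
by apply: eq_bigr => i _; rewrite linearZ mxE deriveE//= mulrC.
Qed.

End row_vectors.

Lemma enorm_le {R : realType} {n : nat} (v : 'rV[R]_n) : enorm v <= n%:R * `|v|.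
Proof.
rewrite /enorm -[leRHS]ger0_norm ?mulr_ge0// -sqrtr_sqr ler_wsqrtr//.
apply: (@le_trans _ _ (n%:R * `|v| ^+ 2)).
  rewrite -[n in n%:R]card_ord mulr_natl -sumr_const; apply: ler_sum => i _.
  by rewrite -real_normK ?num_real// ler_pXn2r ?nnegrE// coord_le_norm.
rewrite exprMn ler_wpM2r ?sqr_ge0// -natrX ler_nat.
by case: n {v} => // m; rewrite -[leqLHS]expn1 leq_pexp2l.
Qed.

Lemma ae_forall_countable d (T : measurableType d) (R : realType)
  (mu : {measure set T -> \bar R}) (I : countType) (P : I -> T -> Prop) :
  (forall i, {ae mu, forall x, P i x}) -> {ae mu, forall x, forall i, P i x}.
Proof.
move=> aeP.
have : {ae mu, forall x, forall n : nat, oapp (fun i => P i x) True (@unpickle I n)}.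
  apply: ae_foralln => n; case: (unpickle n) => [i|] /=; first exact: aeP.
  exact: aeW.
apply: filterS.
by move=> x h i; have := h (pickle i); rewrite pickleK.
Qed.

(** * Differentiability along coordinate lines *)

Section density.
Context {R : realType}.
Notation mu := (@lebesgue_measure R).

(** If [Z] missed the ball of radius [e |h|] around [s + h], it would fill at most a share
    [1 - e / (1 + e)] of the ball of radius [(1 + e) |h|] around [s], for arbitrarily small [h],
    against density 1. Hence near a density point every [s + h] has a point of [Z] at distance
    [o(|h|)]. *)
Lemma density_near (Z : set R) (s : R) : measurable Z ->
  (mu (Z `&` ball s r) * (mu (ball s r))^-1 @[r --> 0^'+] --> 1)%E ->
  forall e : R, 0 < e -> exists2 d : R, 0 < d &
    forall h : R, 0 < `|h| -> `|h| < d -> exists2 h', `|h' - h| <= e * `|h| & Z (s + h').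
Proof.
move=> mZ dZ e e0.
have ee : 0 < 1 + e by rewrite addr_gt0.
have : (nbhs 1%E : set_system (\bar R)) [set y | ((1 - e / (1 + e))%:E < y)%E].
  apply: open_ereal_gt'; rewrite lte_fin ltrBlDr ltrDl divr_gt0//.
move/dZ; rewrite -/(nbhs _ _) => -[r /= r0 rP].
exists (r / (1 + e)); first by rewrite divr_gt0.
move=> h h0; rewrite ltr_pdivlMr// => hr.
apply: contrapT => noh.
pose B' := ball (s + h) (e * `|h|); pose B := ball s ((1 + e) * `|h|).
have B0 : 0 < (1 + e) * `|h| by rewrite mulr_gt0.
have B0' : 0 < e * `|h| by rewrite mulr_gt0.
have dis : [disjoint (Z `&` B) & B'].
  apply/disj_setPS => x [[Zx _]]; rewrite /B' /ball /= => xh.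
  apply: noh; exists (x - s); last by rewrite addrC subrK.
  by rewrite distrC opprB addrA (addrC h) ltW.
have sub : (Z `&` B) `|` B' `<=` B.
  move=> x [[]//|]; rewrite /B /B' /ball /= => xh.
  rewrite (_ : s - x = (s + h - x) - h); last by ring.
  rewrite (le_lt_trans (ler_normB _ _))// mulrDl mul1r addrC ltrD2l//.
have mB : measurable B by apply: open_measurable; exact: ball_open.
have mB' : measurable B' by apply: open_measurable; exact: ball_open.
have muB : mu B = ((1 + e) * `|h| *+ 2)%:E by rewrite lebesgue_measure_ball ?ltW.
have muB' : mu B' = (e * `|h| *+ 2)%:E by rewrite lebesgue_measure_ball ?ltW.
have mZB : measurable (Z `&` B) by exact: measurableI.
have le1 : (mu (Z `&` B) + mu B' <= mu B)%E.
  rewrite -measureU//; last by apply/eqP; rewrite disj_set2E in dis.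
  by apply: le_measure => //; rewrite inE//; exact: measurableU.
rewrite muB muB' in le1.
have := rP ((1 + e) * `|h|).
rewrite mulrC in hr; rewrite /= distrC subr0 gtr0_norm// => /(_ hr B0).
rewrite -/B muB.
have mfin : mu (Z `&` B) \is a fin_num.
  rewrite ge0_fin_numE//; apply: (@le_lt_trans _ _ (mu B)); last by rewrite muB ltry.
  by apply: le_measure; rewrite ?inE// => x [].
move: le1; rewrite -(fineK mfin); set m := fine _.
have B2 : (1 + e) * `|h| *+ 2 != 0 by rewrite mulrn_eq0 /= gt_eqF.
rewrite inver (negbTE B2) -EFinD -EFinM lee_fin lte_fin => le1.
rewrite ltr_pdivlMr; last by rewrite pmulrn_lgt0.
rewrite (_ : (1 - e / (1 + e)) * _ = `|h| *+ 2); last first.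
  by field; rewrite gt_eqF.
by rewrite ltNge => /negP; apply; move: le1; rewrite mulrDl mul1r mulrnDl; lra.
Qed.

End density.

(** * Differentiability along a set of axes, tested with rational slopes *)

Section approx.
Context {R : realType} {n : nat} (f : 'rV[R]_n -> R) (L : R).
Hypothesis fL : forall x y, `|f x - f y| <= L * `|x - y|.
Implicit Types (S : pred 'I_n) (x w q : 'rV[R]_n) (e d : R).
Notation mu := (@lebesgue_measure R).

Definition supported S w := forall i, ~~ S i -> w ord0 i = 0.

Definition approx S q e d : set 'rV[R]_n :=
  [set x | forall w, supported S w -> `|w| <= d ->
    `|f (x + w) - f x - dot q w| <= e * `|w|].

(* Differentiability along the coordinates in [S]; the rational slopes make it
   a countable combination of the closed sets [approx S q e d]. *)
Definition diff_along S : set 'rV[R]_n :=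
  [set x | forall m : nat, exists (q : 'rV[rat]_n) (j : nat),
    approx S (map_mx ratr q) m.+1%:R^-1 j.+1%:R^-1 x].

Let fc : continuous f.
Proof. exact: (lipschitz_continuous fL). Qed.

Lemma approx_closed S q e d : closed (approx S q e d).
Proof.
rewrite (_ : approx _ _ _ _ = \bigcap_(w in [set w | supported S w /\ `|w| <= d])
   (fun x => `|f (x + w) - f x - dot q w|) @^-1` [set t | t <= e * `|w|]); last first.
  apply/seteqP; split => [x Ax w [Sw wd]|x Ax w Sw wd]; first exact: Ax.
  exact: (Ax w (conj Sw wd)).
apply: closed_bigI => w _.
have gc : continuous (fun x => `|f (x + w) - f x - dot q w| : R).
  apply: (@lipschitz_continuous _ _ _ _ (L + L)) => x y.
  apply: (le_trans (ler_dist_dist _ _)).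
  rewrite (_ : _ - _ = (f (x + w) - f (y + w)) - (f x - f y)); last by ring.
  apply: (le_trans (ler_normB _ _)); rewrite mulrDl lerD//.
  by apply: (le_trans (fL _ _)); rewrite opprD addrACA subrr addr0.
by apply: (preimage_closed _ (@closed_le R _)) => x _; exact: gc.
Qed.

Lemma approx_le S q e e' d d' : e <= e' -> d' <= d ->
  approx S q e d `<=` approx S q e' d'.
Proof.
move=> ee' dd' x Ax w Sw wd; apply: (le_trans (Ax w Sw (le_trans wd dd'))).
by rewrite ler_wpM2r.
Qed.

(** Increments supported in [S] only see the coordinates of the slope in [S], so nothing is asked of
    the others. *)
Lemma approx_perturb S q q' e eta d :
  (forall i, S i -> `|q' ord0 i - q ord0 i| <= eta) -> 0 <= eta ->
  approx S q e d `<=` approx S q' (e + n%:R * eta) d.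
Proof.
move=> qq' eta0 x Ax w Sw wd.
rewrite (_ : _ - _ = (f (x + w) - f x - dot q w) - dot (q' - q) w); last first.
  by rewrite dotDl dotNl; ring.
apply: (le_trans (ler_normB _ _)); rewrite mulrDl; apply: lerD; first exact: Ax.
apply: dot_bound => i; have [Si|Si] := boolP (S i); last first.
  by rewrite (Sw _ Si) normr0 mulr0 mulr_ge0.
by apply: ler_pM => //; [rewrite !mxE qq'|exact: coord_le_norm].
Qed.

Lemma inv_nat_lt e : 0 < e -> exists m : nat, m.+1%:R^-1 < e.
Proof.
move=> e0; exists (Num.truncn e^-1).
by rewrite invf_plt ?posrE// truncnS_gt.
Qed.

Lemma diff_alongP S x : diff_along S x <->
  forall e, 0 < e -> exists (q : 'rV[R]_n) d, 0 < d /\ approx S q e d x.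
Proof.
split => [Dx e e0|Dx m].
  have [m me] := inv_nat_lt e0; have [q [j Ax]] := Dx m.
  by exists (map_mx ratr q), j.+1%:R^-1; split=> //; apply: approx_le Ax => //; exact: ltW.
pose e : R := m.+1%:R^-1 / 2; have e0 : 0 < e by rewrite divr_gt0.
have [q [d [d0 Ax]]] := Dx _ e0.
have [j jd] := inv_nat_lt d0.
(* Rounding all slopes by [eta] costs [n * eta], which is at most [e]; the denominator [n.+1] is
   never zero. *)
pose eta := e / n.+1%:R; have eta0 : 0 < eta by rewrite divr_gt0.
have rat_near (i : 'I_n) : exists r : rat, `|ratr r - q ord0 i| <= eta.
  have [r] := @rat_in_itvoo R (q ord0 i - eta) (q ord0 i + eta) ltac:(lra).
  by rewrite in_itv/= => rP; exists r; rewrite ler_distl; lra.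
have [r rP] := choice rat_near.
exists (\row_i r i), j.
apply: (@approx_le S _ (e + n%:R * eta) _ d); last first.
- by apply: approx_perturb Ax => [i _|]; [rewrite !mxE|exact: ltW].
- exact: ltW.
- have en : n%:R * eta <= e.
    by rewrite mulrCA ger_pMr// ler_pdivrMr// mul1r ler_nat.
  have ee : e + e = m.+1%:R^-1 by rewrite -splitr.
  by rewrite -ee lerD2l.
Qed.

(** Tested on a short increment along an axis in [S], two approximate slopes differ by at most the
    sum of their precisions. The intervals around them thus meet pairwise, and the supremum of the
    lower ends lies in all of them. *)
Lemma diff_along_gradient S x : diff_along S x ->
  exists p, forall e, 0 < e -> exists2 d, 0 < d & approx S p e d x.
Proof.
move=> Dx.
have /choice[F FP] : forall m : nat, exists qd : 'rV[R]_n * R,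
    0 < qd.2 /\ approx S qd.1 m.+1%:R^-1 qd.2 x.
  by move=> m; have [q [d]] := (diff_alongP S x).1 Dx m.+1%:R^-1 ltac:(by []); exists (q, d).
pose q m := (F m).1.
have qle i m l : S i -> q m ord0 i - m.+1%:R^-1 <= q l ord0 i + l.+1%:R^-1.
  move=> Si; have [dm0 Am] := FP m; have [dl0 Al] := FP l.
  pose s := Num.min (F m).2 (F l).2.
  have s0 : 0 < s by rewrite lt_min dm0.
  pose w : 'rV[R]_n := s *: delta_mx ord0 i.
  have nw : `|w| = s by rewrite normrZ norm_delta mulr1 gtr0_norm.
  have Sw : supported S w.
    move=> j Sj; rewrite !mxE eqxx /=; case: eqVneq => [ji|_]; last by rewrite mulr0.
    by rewrite ji Si in Sj.
  have dw : dot (q m) w = s * q m ord0 i by rewrite dotZr dot_delta.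
  have dw' : dot (q l) w = s * q l ord0 i by rewrite dotZr dot_delta.
  have := Am w Sw; have := Al w Sw.
  rewrite nw !ge_min !lexx orbT dw dw' => /(_ isT) + /(_ isT).
  rewrite !ler_distl => /andP[l1 l2] /andP[m1 m2].
  rewrite -(ler_pM2l s0) mulrBr mulrDr.
  by move: l1 l2 m1 m2; move: (m.+1%:R^-1) (l.+1%:R^-1) => em el; lra.
(* For [i] outside [S] the supremum may be a default value, multiplied only by coordinates that
   vanish. *)
pose p : 'rV[R]_n := \row_i sup [set q m ord0 i - m.+1%:R^-1 | m in [set: nat]].
have pq i m : S i -> `|p ord0 i - q m ord0 i| <= m.+1%:R^-1.
  move=> Si; rewrite mxE ler_distl; apply/andP; split.
    apply: ub_le_sup; last by exists m.
    by exists (q m ord0 i + m.+1%:R^-1) => _ [l _ <-]; exact: qle.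
  apply: ge_sup; first by exists (q m ord0 i - m.+1%:R^-1); exists m.
  by move=> _ [l _ <-]; exact: qle.
exists p => e e0.
have [m me] := @inv_nat_lt (e / (1 + n%:R)) ltac:(by rewrite divr_gt0// ltr_wpDr).
have [dm0 Am] := FP m; exists (F m).2 => //.
apply: (@approx_le S _ (m.+1%:R^-1 + n%:R * m.+1%:R^-1) _ (F m).2) => //.
  by rewrite -{1}[_^-1]mul1r -mulrDl mulrC -ler_pdivlMr ?ltr_wpDr// ltW.
by apply: approx_perturb Am => // i Si; exact: pq.
Qed.

End approx.

Section derive_eps.
Context {R : realType} {V : normedModType R}.

Lemma is_derive_eps (f : V -> R) (x v : V) (p : R) :
  is_derive x v f p <-> forall e : R, 0 < e -> exists2 d : R, 0 < d &
    forall h : R, `|h| <= d -> `|f (x + h *: v) - f x - p * h| <= e * `|h|.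
Proof.
have quotE (h : R) : h != 0 ->
    `|p - h^-1 *: (f (h *: v + x) - f x)| * `|h| = `|f (x + h *: v) - f x - p * h|.
  move=> h0; rewrite -normrM -normrN; congr `|_|.
  by rewrite (addrC x) mulrBl /GRing.scale /=; field.
split => [[dv dE] e e0|H].
  have /cvgrPdist_le/(_ _ e0) : h^-1 *: (f (h *: v + x) - f x) @[h --> 0^'] --> p.
    by rewrite -dE; exact: dv.
  move=> [d /= d0 dP]; exists (d / 2); first by rewrite divr_gt0.
  move=> h hd; have [->|h0] := eqVneq h 0.
    by rewrite scale0r addr0 mulr0 subrr subr0 normr0 mulr0.
  rewrite -quotE// ler_wpM2r//; apply: dP => //=.
  by rewrite distrC subr0 (le_lt_trans hd)// ltr_pdivrMr// ltr_pMr// ltr1n.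
have cv : h^-1 *: (f (h *: v + x) - f x) @[h --> 0^'] --> p.
  apply/cvgrPdist_le => e e0; have [d d0 dP] := H _ e0.
  exists d => //= h /=; rewrite distrC subr0 => hd h0.
  have h0' : 0 < `|h| by rewrite normr_gt0.
  by rewrite -(ler_pM2r h0') quotE// dP// ltW.
split; first by apply/cvg_ex; exists p.
by apply/cvg_lim => //; exact: Rhausdorff.
Qed.

End derive_eps.

Section approx_line.
Context {R : realType} {n : nat} (f : 'rV[R]_n -> R) (L : R).
Hypothesis fL : forall x y, `|f x - f y| <= L * `|x - y|.
Implicit Types (S : pred 'I_n) (x w q : 'rV[R]_n) (e d : R).
Notation mu := (@lebesgue_measure R).

Lemma supported1 k w : supported (pred1 k) w -> w = w ord0 k *: delta_mx ord0 k.
Proof.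
move=> Sw; apply/rowP => j; rewrite !mxE eqxx /=.
by case: eqVneq => [->|jk]; rewrite ?mulr1// mulr0 Sw.
Qed.

Lemma diff_along1 k x :
  diff_along f (pred1 k) x <-> derivable f x (delta_mx ord0 k).
Proof.
split => [Dx|dx].
  have [p pP] := diff_along_gradient Dx.
  suff : is_derive x (delta_mx ord0 k) f (p ord0 k) by case.
  apply/is_derive_eps => e e0; have [d d0 Ad] := pP e e0.
  exists d => // h hd.
  have nw : `|h *: delta_mx ord0 k : 'rV[R]_n| = `|h| by rewrite normrZ norm_delta mulr1.
  have := Ad (h *: delta_mx ord0 k); rewrite nw dotZr dot_delta (mulrC h); apply => //.
  by move=> j /= jk; rewrite !mxE eqxx /= (negbTE jk) mulr0.
apply/diff_alongP => e e0.
have dE : is_derive x (delta_mx ord0 k) f ('D_(delta_mx ord0 k) f x) by [].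
have [d d0 dP] := (is_derive_eps _ _ _ _).1 dE e e0.
exists ('D_(delta_mx ord0 k) f x *: delta_mx ord0 k), d; split => // w Sw wd.
rewrite dotC dotZr dot_delta {1}(supported1 Sw).
apply: (le_trans (dP _ _)); first exact: le_trans (coord_le_norm _ _) wd.
by rewrite ler_wpM2l ?(ltW e0)// coord_le_norm.
Qed.

Lemma diff_alongT x : diff_along f predT x -> differentiable f x.
Proof.
move=> /diff_along_gradient[p pP]; apply: (@differentiable_dot _ _ _ _ p) => e e0.
by have [d d0 Ad] := pP e e0; exists d => // w wd; exact: Ad.
Qed.

(* The difference quotient along [w' + h v], with [w'] supported in [S], is
   estimated from the line point [y + h' v] of the same approximation set that
   density provides next to [y + h v]. *)
Lemma diff_along_line S k x (t : R) : t != 0 ->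
  {ae mu, forall s : R, 0 < s < 1 ->
    diff_along f S (x + s *: (t *: delta_mx ord0 k)) ->
    diff_along f (predU1 k S) (x + s *: (t *: delta_mx ord0 k))}.
Proof.
move=> t0; set v := t *: delta_mx ord0 k.
have nv : `|v| = `|t| by rewrite normrZ norm_delta mulr1.
have t0' : 0 < `|t| by rewrite normr_gt0.
pose g s := f (x + s *: v).
have gL r s : `|g r - g s| <= L * `|t| * `|r - s|.
  apply: (le_trans (fL _ _)).
  by rewrite opprD addrACA subrr add0r -scalerBl normrZ nv mulrAC mulrA.
have [phi [_ dphi _]] := lipschitz_density gL.
pose A (i : 'rV[rat]_n * nat * nat) : set 'rV[R]_n :=
  approx f S (map_mx ratr i.1.1) i.1.2.+1%:R^-1 i.2.+1%:R^-1.
pose Z i : set R := [set s | A i (x + s *: v)].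
have mZ i : measurable (Z i).
  apply: closed_measurable.
  have lc : continuous (fun s : R => x + s *: v).
    apply: (@lipschitz_continuous _ _ _ _ `|v|) => r s.
    by rewrite opprD addrACA subrr add0r -scalerBl normrZ mulrC.
  by apply: (preimage_closed _ (@approx_closed _ _ _ _ fL _ _ _ _)) => s _; exact: lc.
(* Density is secured for all the countably many sets at once, since the index is chosen only after
   [s]. *)
have dens : {ae mu, forall s : R, forall i, (mu (Z i `&` ball s r) * (mu (ball s r))^-1
                      @[r --> 0^'+] --> (\1_(Z i) s)%:E)%E}.
  by apply: ae_forall_countable => i; exact: lebesgue_density.
apply: (filterS2 _ _ dphi dens); first exact: (ae_filter_ringOfSetsType mu).
move=> s {}dphi {}dens s01 Dy; set y := x + s *: v in Dy *.
have {}dphi := dphi s01.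
apply/diff_alongP => e e0.
(* Replacing [h] by [h'] changes a value of [f] by at most [(|L| + 1) * |t| * e1 * |h|], that is
   [e / 4 * |t * h|]. *)
pose e1 := e / 4 / (`|L| + 1).
have L0 : 0 < `|L| + 1 by rewrite ltr_wpDl.
have e10 : 0 < e1 by rewrite !divr_gt0.
have [m me] := @inv_nat_lt R (e / 4) ltac:(by rewrite divr_gt0).
have [q [j Ay]] := Dy m.
have sZ : Z (q, m, j) s by [].
have := dens (q, m, j); rewrite indicE mem_set//.
move=> /(density_near (mZ _))/(_ _ e10)[d1 d10 near1].
have [d2 d20 near2] := (is_derive_eps _ _ _ _).1 dphi (e / 4 * `|t|) ltac:(by rewrite mulr_gt0// divr_gt0).
pose qr : 'rV[R]_n := map_mx ratr q.
(* The [k]-th slope becomes the true one: [phi s] is the derivative along [t] times the axis vector,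
   hence the division by [t]. *)
exists (qr + (phi s / t - qr ord0 k) *: delta_mx ord0 k).
exists (Num.min j.+1%:R^-1 (Num.min (d1 * `|t| / 2) (d2 * `|t|))).
split; first by rewrite !lt_min invr_gt0 ltr0n /= divr_gt0 ?mulr_gt0.
move=> w Sw; rewrite !le_min => /and3P[wj wd1 wd2].
pose wk := w ord0 k; pose h := wk / t; pose w' := w - wk *: delta_mx ord0 k.
have hv : h *: v = wk *: delta_mx ord0 k by rewrite scalerA divfK.
have wE : w = h *: v + w' by rewrite hv addrC subrK.
have wkw : `|wk| <= `|w| by exact: coord_le_norm.
have ht : `|h| * `|t| = `|wk| by rewrite -normrM divfK.
have w'i i : w' ord0 i = if i == k then 0 else w ord0 i.
  rewrite !mxE eqxx /=; case: eqVneq => [->|_]; first by rewrite mulr1 subrr.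
  by rewrite mulr0 subr0.
have Sw' : supported S w'.
  by move=> i Si; rewrite w'i; case: eqVneq => // ik; apply: Sw; rewrite /= negb_or ik.
have nw' : `|w'| <= `|w|.
  apply: norm_row_le => // i; rewrite w'i; case: ifP => _; first by rewrite normr0.
  exact: coord_le_norm.
have [h' hh' Zh'] : exists2 h', `|h' - h| <= e1 * `|h| & Z (q, m, j) (s + h').
  have [h0|h0] := eqVneq h 0.
    by exists 0; rewrite ?addr0// h0 subrr normr0 mulr0.
  apply: near1; rewrite ?normr_gt0// -(ltr_pM2r t0') ht.
  apply: (le_lt_trans wkw); apply: (le_lt_trans wd1).
  by rewrite ltr_pdivrMr// ltr_pMr ?mulr_gt0// ltr1n.
have Aw := Zh' w' Sw' (le_trans nw' wj).
have Lh : L * (`|t| * `|h - h'|) <= e / 4 * `|w|.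
  apply: (@le_trans _ _ ((`|L| + 1) * (`|t| * `|h - h'|))).
    by rewrite ler_wpM2r ?mulr_ge0// (le_trans (ler_norm _))// lerDl.
  apply: (@le_trans _ _ ((`|L| + 1) * (`|t| * (e1 * `|h|)))).
    by rewrite ler_wpM2l ?(ltW L0)// ler_wpM2l// distrC.
  rewrite [leLHS](_ : _ = e / 4 * (`|h| * `|t|)); last first.
    by rewrite /e1; field; rewrite gt_eqF.
  by rewrite ht ler_wpM2l// divr_ge0// ltW.
have gB r1 r2 u : `|f (x + r1 *: v + u) - f (x + r2 *: v + u)| <= L * (`|t| * `|r1 - r2|).
  apply: (le_trans (fL _ _)).
  by rewrite opprD addrACA subrr addr0 opprD addrACA subrr add0r -scalerBl normrZ nv mulrC
    [`|t| * _]mulrC mulrC.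
have yw : y + w = x + (s + h) *: v + w' by rewrite wE scalerDl /y !addrA.
have B1 := gB (s + h) (s + h') w'.
have B2 := gB (s + h') (s + h) 0.
have B3 := near2 h.
rewrite yw dotDl dotZl (dotC (delta_mx _ _)) dot_delta -/wk.
have dw' : dot qr w' = dot qr w - wk * qr ord0 k by rewrite dotDr dotNr dotZr dot_delta.
(* Four terms, each at most [e / 4 * |w|]: a shift from [h] to [h'] in the presence of [w'], the
   approximation at the shifted point, the shift back without [w'], and the derivative along the
   line. *)
rewrite (_ : _ - _ = (f (x + (s + h) *: v + w') - f (x + (s + h') *: v + w')) +
   (f (x + (s + h') *: v + w') - f (x + (s + h') *: v) - dot qr w') +
   (f (x + (s + h') *: v + 0) - f (x + (s + h) *: v + 0)) +
   (g (s + h *: 1) - g s - phi s * h)); last first.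
  rewrite /g -/y dw' !addr0 /h [_ *: 1]mulr1; by field.
apply: (le_trans (ler_normD _ _)).
apply: (le_trans (lerD (ler_normD _ _) (lexx _))).
apply: (le_trans (lerD (lerD (ler_normD _ _) (lexx _)) (lexx _))).
rewrite (_ : e * _ = e / 4 * `|w| + e / 4 * `|w| + e / 4 * `|w| + e / 4 * `|w|); last by field.
apply: lerD; first apply: lerD; first apply: lerD.
- by apply: (le_trans B1); rewrite opprD addrACA subrr add0r.
- apply: (le_trans Aw); apply: ler_pM => //; exact: ltW.
- by apply: (le_trans B2); rewrite opprD addrACA subrr add0r distrC.
- apply: (le_trans (B3 _)).
    by rewrite -(ler_pM2r t0') ht (le_trans wkw).
  by rewrite -mulrA (mulrC `|t|) ht ler_wpM2l// divr_ge0// ltW.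
Qed.

End approx_line.

(** * Generic curves *)

Section null_sections.
Context d1 d2 (T1 : measurableType d1) (T2 : measurableType d2) (R : realType).
Variables (m1 : {sigma_finite_measure set T1 -> \bar R})
          (m2 : {sigma_finite_measure set T2 -> \bar R}).

Lemma null_ysections_integral (A : set (T1 * T2)) : measurable A ->
  (forall y, m1 (ysection A y) = 0%E) -> (\int[m1]_x m2 (xsection A x) = 0)%E.
Proof.
move=> mA A0; have := indic_fubini_tonelli m1 m2 mA.
rewrite indic_fubini_tonelli_FE// indic_fubini_tonelli_GE//= => ->.
by under eq_integral do rewrite A0; exact: integral0.
Qed.

Lemma null_ysections_product (A : set (T1 * T2)) : measurable A ->
  (forall y, m1 (ysection A y) = 0%E) -> ((m1 \x m2) A = 0)%E.
Proof. exact: null_ysections_integral. Qed.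

Lemma null_ysections_xsections (A : set (T1 * T2)) : measurable A ->
  (forall y, m1 (ysection A y) = 0%E) ->
  {ae m1, forall x, m2 (xsection A x) = 0%E}.
Proof.
move=> mA /(null_ysections_integral mA) A0.
have /(ae_eq_integral_abs m1 measurableT (measurable_fun_xsection m2 mA)) :
    (\int[m1]_x `|m2 (xsection A x)| = 0)%E.
  by rewrite -[RHS]A0; apply: eq_integral => x _; rewrite gee0_abs.
by apply: filterS => x /(_ I).
Qed.

End null_sections.

(** * Coordinatewise measurable maps into [R^n] *)

Definition measurable_row {R : realType} {n : nat} d (T : measurableType d)
  (X : T -> 'rV[R]_n) := forall i, measurable_fun setT (fun t => X t ord0 i).

Section measurable_rows.
Context {R : realType} {n : nat}.

(** An open set is the union of the countably many rational cubes inside it, and a cube is a finite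
    conjunction of conditions on coordinates. *)
Lemma measurable_row_open d (T : measurableType d) (X : T -> 'rV[R]_n) (O : set 'rV[R]_n) :
  measurable_row X -> open O -> measurable (X @^-1` O).
Proof.
move=> mX oO.
pose box (q : 'rV[rat]_n * nat) : set 'rV[R]_n :=
  [set v | forall i, `|v ord0 i - ratr (q.1 ord0 i)| < q.2.+1%:R^-1].
have mbox q : measurable (X @^-1` box q).
  rewrite (_ : _ @^-1` _ = \bigcap_(i in [set: 'I_n])
      ((fun t => X t ord0 i) @^-1` ball (ratr (q.1 ord0 i) : R) (q.2.+1%:R^-1))).
    apply: fin_bigcap_measurable => // i _; rewrite -[_ @^-1` _]setTI.
    by apply: mX => //; exact: measurable_ball.
  apply/seteqP; split => t /= h i; first by move=> _; rewrite /ball/= distrC.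
  by rewrite distrC; exact: h.
rewrite (_ : O = \bigcup_(q in [set q | box q `<=` O]) box q); last first.
  apply/seteqP; split => [v Ov|v [q /= + vq]]; last exact.
  have /nbhs_ballP[e /= e0 eO] := open_nbhs_nbhs (conj oO Ov).
  have [m me] := @inv_nat_lt R (e / 2) ltac:(by rewrite divr_gt0).
  have /choice[r rP] (i : 'I_n) : exists r : rat, `|v ord0 i - ratr r| < m.+1%:R^-1.
    have m0 : (0 : R) < m.+1%:R^-1 by [].
    have [r] := @rat_in_itvoo R (v ord0 i) (v ord0 i + m.+1%:R^-1) ltac:(by rewrite ltrDl).
    rewrite in_itv/= => /andP[r1 r2]; exists r.
    by rewrite distrC ger0_norm ?subr_ge0 ?(ltW r1)// ltrBlDl.
  exists (\row_i r i, m) => /=; last by move=> i; rewrite mxE.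
  move=> w wb; apply: eO; rewrite -ball_normE /=; rewrite [e]splitr.
  apply: (@le_lt_trans _ _ (2 * m.+1%:R^-1)); last by rewrite -splitr -ltr_pdivlMl// mulrC.
  apply: norm_row_le => // i; rewrite !mxE.
  have := wb i; rewrite mxE => wi; have := rP i => vi.
  rewrite (_ : _ + _ = (v ord0 i - ratr (r i)) - (w ord0 i - ratr (r i))); last by ring.
  by rewrite (le_trans (ler_normB _ _))// mulr2n mulrDl mul1r lerD ?ltW.
rewrite preimage_bigcup bigcup_mkcond.
apply: countable_bigcupT_measurable; first exact: countableP.
by move=> q; case: ifP => _; [exact: mbox|exact: measurable0].
Qed.

Lemma measurable_row_comp d (T : measurableType d) (X : T -> 'rV[R]_n)
  (f : 'rV[R]_n -> R) : measurable_row X -> continuous f ->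
  measurable_fun setT (f \o X).
Proof.
move=> mX cf; apply: (measurability (@RGenOpens.G R)) => //; first exact: RGenOpens.measurableE.
move=> _ [_ [a [b ->]] <-]; rewrite setTI.
apply: (measurable_row_open mX (_ : open (f @^-1` `]a, b[%classic))).
by move/continuousP : cf; apply; exact: interval_open.
Qed.

(** Stands for Borel sets: quantifying over all coordinatewise measurable maps avoids fixing a
    sigma-algebra on rows. *)
Definition row_measurable (B : set 'rV[R]_n) := forall d (T : measurableType d)
  (X : T -> 'rV[R]_n), measurable_row X -> measurable (X @^-1` B).

Lemma row_measurable_closed (B : set 'rV[R]_n) : closed B -> row_measurable B.
Proof.
move=> cB d T X mX; rewrite -[B]setCK preimage_setC; apply: measurableC.
exact: (measurable_row_open mX (closed_openC cB)).
Qed.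

Lemma row_measurableD (A B : set 'rV[R]_n) :
  row_measurable A -> row_measurable B -> row_measurable (A `\` B).
Proof.
by move=> mA mB d T X mX; exact: measurableD (mA _ _ _ mX) (mB _ _ _ mX).
Qed.

End measurable_rows.

(** * A random vector with independent uniform coordinates *)

Section generic_row.
Context {R : realType} {n : nat}.
Notation mu := (@lebesgue_measure R).

Let itv01_measurable : measurable (`]0, 1[%classic : set (measurableTypeR R)).
Proof. exact: measurable_itv. Qed.

Let itv01_lty : (mu (`]0%R, 1%R[%classic : set R) < +oo)%E.
Proof. by rewrite lebesgue_measure_itv/= lte_fin ltr01 ltry. Qed.

Definition unit_itv_measure : set (measurableTypeR R) -> \bar R :=
  mfrestr itv01_measurable itv01_lty.

HB.instance Definition _ := Measure.on unit_itv_measure.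

Lemma unit_itv_measureT : (unit_itv_measure setT = 1)%E.
Proof.
rewrite /unit_itv_measure /mfrestr /mrestr setTI.
have : (mu (`]0%R, 1%R[%classic : set R) = 1)%E.
  by rewrite lebesgue_measure_itv/= lte_fin ltr01 oppr0 adde0.
by [].
Qed.

Let unit_itv_measure_le1 : (unit_itv_measure setT <= 1)%E.
Proof. by rewrite unit_itv_measureT. Qed.

HB.instance Definition _ :=
  Measure_isSubProbability.Build _ _ _ unit_itv_measure unit_itv_measure_le1.

Lemma unit_itv_measure0 (A : set R) : measurable A ->
  {ae mu, forall s, 0 < s < 1 -> ~ A s} -> unit_itv_measure A = 0%E.
Proof.
move=> mA A0; rewrite /unit_itv_measure /= /mfrestr /mrestr.
apply: measure_negligible; first exact: measurableI.
apply: negligibleS A0 => s [As]; rewrite /= in_itv/= => s01 /(_ s01).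
exact.
Qed.

(** The range []0, 1[] is that of the uniform law, and the scale [t] will absorb the factor in front
    of the random vector. *)
Definition line_null (B : set 'rV[R]_n) k := forall x (t : R), t != 0 ->
  {ae mu, forall s : R, 0 < s < 1 -> ~ B (x + s *: (t *: delta_mx ord0 k))}.

(* [Y] has its first [m] coordinates independent and uniform on ]0, 1[, the
   remaining ones being 0. *)
Lemma random_row (m : nat) : (m <= n)%N ->
  exists (d : measure_display) (T : measurableType d)
    (P : subprobability T R) (Y : T -> 'rV[R]_n),
    [/\ P setT != 0%E, measurable_row Y &
     forall k : 'I_n, (k < m)%N -> forall B, row_measurable B -> line_null B k ->
     forall c t, t != 0 -> P [set w | B (c + t *: Y w)] = 0%E].
Proof.
elim: m => [_|m IH mn].
  exists _, (measurableTypeR R), unit_itv_measure, (fun=> 0); split=> //.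
    by rewrite [X in X != _]unit_itv_measureT.
have [d [T [P [Y [PT mY PB]]]]] := IH (ltnW mn).
pose km : 'I_n := Ordinal mn.
pose Y' (w : T * measurableTypeR R) : 'rV[R]_n := Y w.1 + (w.2 : R) *: delta_mx ord0 km.
have mY' : measurable_row Y'.
  move=> i; rewrite (_ : (fun w => _) = (fun w : T * measurableTypeR R =>
      Y w.1 ord0 i + (w.2 : R) * (delta_mx ord0 km : 'rV[R]_n) ord0 i)); last first.
    by apply/funext => w; rewrite !mxE.
  apply: measurable_funD; first exact: (measurableT_comp (mY i) measurable_fst).
  by apply: measurable_funM; [exact: measurable_snd|exact: measurable_cst].
have mcY c t : measurable_row (fun w => c + t *: Y' w).
  move=> i; rewrite (_ : (fun w => _) = (fun w => c ord0 i + t * Y' w ord0 i)); last first.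
    by apply/funext => w; rewrite !mxE.
  by apply: measurable_funD => //; apply: measurable_funM.
pose PU := product_subprobability (P, unit_itv_measure : subprobability (measurableTypeR R) R).
exists _, (T * measurableTypeR R)%type, PU, Y'; split => //.
  by rewrite -setXTT [X in X != _]product_measure1E// [X in (_ * X)%E]unit_itv_measureT mule1.
move=> k; rewrite ltnS leq_eqVlt => /orP[/eqP km'|km'] B mB B0 c t t0.
  have kE : k = km by apply/val_inj.
  (* With the old coordinates frozen, the new one moves the point along the [k]-th axis, where [B]
     is null. *)
  rewrite /product_measure1; apply: integral0_eq => w _ /=.
  apply: unit_itv_measure0.
    by apply: measurable_xsection; exact: (mB _ _ _ (mcY c t)).
  apply: filterS (B0 (c + t *: Y w) t t0); first exact: (ae_filter_ringOfSetsType mu).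
  move=> s + s01 => /(_ s01); rewrite /xsection /= inE /= /Y' /= kE scalerDr addrA.
  by rewrite scalerA mulrC -scalerA.
(* Here the new coordinate is frozen and absorbed into the translation [c], over which the induction
   hypothesis is uniform. *)
apply: null_ysections_product; first exact: (mB _ _ _ (mcY c t)).
move=> s; rewrite -[RHS](PB k km' B mB B0 (c + t *: (s *: delta_mx ord0 km)) t t0).
congr (P _); apply/seteqP; split => w; rewrite /ysection /= inE /= /Y' /= scalerDr;
  by rewrite [t *: Y w + _]addrC addrA.
Qed.

End generic_row.

Section generic_curve.
Context {R : realType} {n : nat} (f : 'rV[R]_n -> R) (L : R).
Hypothesis fL : forall x y, `|f x - f y| <= L * `|x - y|.
Notation mu := (@lebesgue_measure R).

Lemma row_measurable_diff_along S : row_measurable (diff_along f S).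
Proof.
move=> d T X mX.
rewrite (_ : diff_along f S = \bigcap_(m in [set: nat]) \bigcup_(q in [set: 'rV[rat]_n])
   \bigcup_(j in [set: nat]) approx f S (map_mx ratr q) m.+1%:R^-1 j.+1%:R^-1).
  rewrite preimage_bigcap; apply: bigcapT_measurable => m.
  rewrite preimage_bigcup; apply: countable_bigcupT_measurable; first exact: countableP.
  move=> q; rewrite preimage_bigcup; apply: bigcup_measurable => j _.
  exact: (row_measurable_closed (@approx_closed _ _ _ _ fL _ _ _ _) mX).
apply/seteqP; split => [x Dx m _|x Dx m].
  by have [q [j A]] := Dx m; exists q => //; exists j.
by have [q _ [j _ A]] := Dx m I; exists q, j.
Qed.

Definition lower (k : nat) : pred 'I_n := fun i => (i < k)%N.

(* Non-differentiability is split into layers, each null on the lines in a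
   coordinate direction. *)
Definition layer k := diff_along f (lower k) `\` diff_along f (lower k.+1).

Lemma layer_line_null (k : 'I_n) : line_null (layer k) k.
Proof.
move=> x t t0.
apply: filterS (diff_along_line fL (lower k) k x t0).
  exact: (ae_filter_ringOfSetsType mu).
move=> s h s01 [D1]; apply.
rewrite (_ : lower k.+1 = predU1 k (lower k)); first exact: h.
by apply/funext => i; rewrite /lower /= ltnS leq_eqVlt.
Qed.

(** The chain starts with the empty set of axes, where only the increment 0 is tested, and ends with
    all axes, where [f] would be differentiable; a point that drops out does so at some stage. *)
Lemma layerP x : ~ differentiable f x -> exists k : 'I_n, layer k x.
Proof.
move=> ndf; apply: contrapT => nlay; apply: ndf; apply: diff_alongT.
have Dk k : (k <= n)%N -> diff_along f (lower k) x.
  elim: k => [_|k IH kn].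
    apply/diff_alongP => e e0; exists 0, 1; split => // w Sw _.
    have -> : w = 0 by apply/rowP => i; rewrite mxE Sw.
    by rewrite addr0 subrr dot0r subr0 !normr0 mulr0.
  apply: contrapT => nD; apply: nlay; exists (Ordinal kn); split => //.
  exact: IH (ltnW kn).
rewrite (_ : (predT : pred 'I_n) = lower n); first exact: Dk.
by apply/funext => i; rewrite /lower ltn_ord.
Qed.

Lemma generic_curves (I : countType) (c : I -> R -> 'rV[R]_n) :
  (forall i, measurable_row (c i)) ->
  exists y : 'rV[R]_n, forall i,
    {ae mu, forall t : R, 0 < t -> differentiable f (c i t + t ^+ 2 *: y)}.
Proof.
move=> mc.
have [d [T [P [Y [PT mY PB]]]]] := @random_row R n n (leqnn n).
pose X i (w : T * measurableTypeR R) : 'rV[R]_n := c i w.2 + (w.2 : R) ^+ 2 *: Y w.1.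
have mX i : measurable_row (X i).
  move=> j; rewrite (_ : (fun w => _) = (fun w : T * measurableTypeR R =>
      c i w.2 ord0 j + (w.2 : R) ^+ 2 * Y w.1 ord0 j)); last first.
    by apply/funext => w; rewrite !mxE.
  apply: measurable_funD; first exact: (measurableT_comp (mc i j) measurable_snd).
  apply: measurable_funM; last exact: (measurableT_comp (mY j) measurable_fst).
  by apply: measurable_funX; exact: measurable_snd.
(* Time 0 is excluded because the perturbation vanishes there. *)
pose A (ik : I * 'I_n) : set (T * measurableTypeR R) :=
  [set w | 0 < (w.2 : R)] `&` X ik.1 @^-1` layer ik.2.
have mA ik : measurable (A ik).
  apply: measurableI.
    rewrite (_ : [set w | _] = snd @^-1` (`]0, +oo[%classic : set R)); last first.
      by apply/seteqP; split => w /=; rewrite in_itv/= andbT.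
    by rewrite -[_ @^-1` _]setTI; apply: measurable_snd => //; exact: measurable_itv.
  apply: (row_measurableD _ _ (mX _)); exact: row_measurable_diff_along.
have A0 ik t : P (ysection (A ik) t) = 0%E.
  have [t0|t0] := ltP 0 (t : R); last first.
    rewrite (_ : ysection _ _ = set0) ?measure0//.
    by apply/seteqP; split => w //; rewrite /ysection /= inE => -[/=]; rewrite ltNge t0.
  rewrite -[RHS](PB ik.2 (ltn_ord _) (layer ik.2) _ (layer_line_null ik.2) (c ik.1 t) (t ^+ 2)).
  - congr (P _); apply/seteqP; split => w; rewrite /ysection /= inE; first by case.
    by split.
  - by apply: row_measurableD; exact: row_measurable_diff_along.
  - by rewrite expf_neq0// gt_eqF.
have aeA : {ae P, forall w, forall ik, mu (xsection (A ik) w) = 0%E}.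
  apply: ae_forall_countable => ik.
  exact: (null_ysections_xsections mu (mA ik) (A0 ik)).
(* An almost sure event is inhabited because [P] has nonzero mass. *)
have [w wA] : exists w, forall ik, mu (xsection (A ik) w) = 0%E.
  apply: contrapT => now; move/eqP: PT; apply.
  apply: measure_negligible => //.
  by apply: negligibleS aeA => w _ /= wA; apply: now; exists w.
exists (Y w) => i.
have aeN : {ae mu, forall t : R, forall k : 'I_n, ~ A (i, k) (w, t)}.
  apply: ae_forall_countable => k.
  exists (xsection (A (i, k)) w); split; [exact: measurable_xsection|exact: wA|].
  by move=> t /= /contrapT At; rewrite /xsection /= inE.
apply: filterS aeN; first exact: (ae_filter_ringOfSetsType mu).
move=> t At t0; apply: contrapT => /layerP[k kl].
exact: (At k).
Qed.

End generic_curve.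

(** * Averages of the gradient *)

Section gradient_integrals.
Context {R : realType} {n : nat} (f : 'rV[R]_n -> R) (L : R).
Hypothesis fL : forall x y, `|f x - f y| <= L * `|x - y|.
Notation mu := (@lebesgue_measure R).

(** Valid at every point: where the difference quotient diverges, the partial derivative is the
    default value 0. Integrability along curves then needs no differentiability. *)
Lemma gradient_bound x i : `|gradient f x ord0 i| <= L.
Proof.
have L0 : 0 <= L.
  apply: (le_trans (normr_ge0 (f (x + delta_mx ord0 i) - f x))).
  by apply: (le_trans (fL _ _)); rewrite addrC addKr norm_delta mulr1.
rewrite mxE.
have [dx|ncv] := pselect (derivable f x (delta_mx ord0 i)); last first.
  by rewrite /derive dvgP// normr0.
set D := 'D_ _ f x.
have dE : is_derive x (delta_mx ord0 i) f D by [].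
apply/ler_addgt0Pr => e e0.
have [h h0 hP] := (is_derive_eps _ _ _ _).1 dE e e0.
have := hP h; rewrite gtr0_norm// lexx => /(_ isT) De.
rewrite -(ler_pM2r h0) -{1}(gtr0_norm h0) -normrM.
rewrite (_ : D * h = (f (x + h *: delta_mx ord0 i) - f x) -
   (f (x + h *: delta_mx ord0 i) - f x - D * h)); last by ring.
apply: (le_trans (ler_normB _ _)); rewrite mulrDl; apply: lerD => //.
apply: (le_trans (fL _ _)).
by rewrite addrC addKr normrZ norm_delta mulr1 gtr0_norm.
Qed.

(** Where the partial derivative exists it is the limit of the quotients with step [1 / (m + 1)];
    elsewhere it is the constant default value. *)
Lemma measurable_gradient d (T : measurableType d) (X : T -> 'rV[R]_n) i :
  measurable_row X -> measurable_fun setT (fun w => gradient f (X w) ord0 i).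
Proof.
move=> mX.
pose E := X @^-1` diff_along f (pred1 i).
have mE : measurable E by exact: (row_measurable_diff_along fL _ mX).
rewrite -(setUv E); apply/measurable_funU => //; first exact: measurableC.
split.
  pose e m : 'rV[R]_n := m.+1%:R^-1 *: delta_mx ord0 i.
  apply: (@measurable_fun_cvg _ _ _ _ (fun m w => m.+1%:R * (f (X w + e m) - f (X w)))).
    move=> m; apply: measurable_funTS.
    apply: measurable_funM => //; apply: measurable_funB.
      apply: (@measurable_row_comp _ _ _ _ X (fun x => f (x + e m))) => //.
      apply: (@lipschitz_continuous _ _ _ _ L) => x y.
      by apply: (le_trans (fL _ _)); rewrite opprD addrACA subrr addr0.
    by apply: measurable_row_comp => //; exact: lipschitz_continuous fL.
  move=> w /diff_along1 dX; rewrite mxE.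
  have dE : is_derive (X w) (delta_mx ord0 i) f ('D_(delta_mx ord0 i) f (X w)) by [].
  apply/cvgrPdist_le => e0 e00.
  have [h h0 hP] := (is_derive_eps _ _ _ _).1 dE e0 e00.
  near=> m.
  have m0 : (0 : R) < m.+1%:R^-1 by rewrite invr_gt0.
  rewrite -(ler_pM2r m0) -{1}(gtr0_norm m0) -normrM -normrN.
  have := hP m.+1%:R^-1; rewrite (gtr0_norm m0) => h1.
  rewrite (_ : - (_ * m.+1%:R^-1) =
      f (X w + e m) - f (X w) - 'D_(delta_mx ord0 i) f (X w) * m.+1%:R^-1); last by field.
  by apply: h1; apply/ltW; near: m; exact: near_infty_natSinv_lt (PosNum h0).
apply: (@eq_measurable_fun _ _ _ _ _ (cst point)) => // w.
rewrite inE /= => nE; rewrite mxE /derive dvgP// => cv; apply: nE.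
exact/diff_along1.
Unshelve. all: by end_near. Qed.

Lemma integrable_bounded (g : R -> R) (a c : R) : measurable_fun setT g ->
  (forall t, t \in `[0, a] -> `|g t| <= c) -> mu.-integrable `[0, a] (EFin \o g).
Proof.
move=> mg gc; apply: measurable_bounded_integrable => //.
- have : (mu (`[0%R, a]%classic : set R) < +oo)%E.
    by rewrite lebesgue_measure_itv/=; case: ifP => _; rewrite ?ltry.
  by [].
- exact: measurable_funTS.
- by exists c; split; [exact: num_real|move=> M cM t /gc h /=]; exact: le_trans h (ltW cM).
Qed.

Lemma integrable_gradient (r : R -> 'rV[R]_n) (a : R) i : measurable_row r ->
  mu.-integrable `[0, a] (EFin \o (fun t => gradient f (r t) ord0 i)).
Proof.
move=> mr; apply: (@integrable_bounded _ _ L); first exact: measurable_gradient.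
by move=> t _; exact: gradient_bound.
Qed.

Lemma measurable_dot (u v : R -> 'rV[R]_n) (D : set R) :
  measurable_row u -> measurable_row v -> measurable_fun D (fun t => dot (u t) (v t)).
Proof.
move=> mu' mv; apply: measurable_funTS; apply: measurable_sum => i.
by apply: measurable_funM; [exact: mu'|exact: mv].
Qed.

Lemma Rintegral_sum (I : Type) (s : seq I) (D : set R) (g : I -> R -> R) :
  measurable D -> (forall i, mu.-integrable D (EFin \o g i)) ->
  \int[mu]_(t in D) (\sum_(i <- s) g i t) = \sum_(i <- s) \int[mu]_(t in D) g i t.
Proof.
move=> mD ig; elim: s => [|i s IH].
  rewrite big_nil; under eq_Rintegral do rewrite big_nil.
  by rewrite Rintegral_cst// mul0r.
rewrite big_cons; under eq_Rintegral do rewrite big_cons.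
rewrite RintegralD// ?IH//.
rewrite (_ : _ \o _ = (fun t => \sum_(i <- s) (g i t)%:E)%E).
  by apply: integrable_sum => // j _; exact: ig.
by apply/funext => t; rewrite /= sumEFin.
Qed.

Definition quad (y : 'rV[R]_n) (t : R) : 'rV[R]_n := t ^+ 2 *: y.

Lemma measurable_curve (x0 g : 'rV[R]_n) o : measurable_row o ->
  measurable_row (curve x0 g o).
Proof.
move=> mo i; rewrite /curve.
rewrite (_ : (fun t => _) = (fun t : R => x0 ord0 i + t * g ord0 i + o t ord0 i)).
  by apply: measurable_funD => //; apply: measurable_funD => //; apply: measurable_funM.
by apply/funext => t; rewrite !mxE.
Qed.

Lemma measurable_quad y : measurable_row (quad y).
Proof.
move=> i; rewrite (_ : (fun t => _) = (fun t : R => t ^+ 2 * y ord0 i)).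
  by apply: measurable_funM => //; apply: measurable_funX.
by apply/funext => t; rewrite !mxE.
Qed.

Lemma is_derive_curve_quad (x0 h y : 'rV[R]_n) (t : R) :
  differentiable f (curve x0 h (quad y) t) ->
  is_derive t (1 : R) (f \o curve x0 h (quad y))
    (dot (gradient f (curve x0 h (quad y) t)) (h + (2 * t) *: y)).
Proof.
set r := curve x0 h (quad y) => df.
have rE (s : R) : s != 0 -> s^-1 *: (r (s *: (1 : R) + t) - r t) = h + (2 * t) *: y + s *: y.
  move=> s0; rewrite /r /curve /quad [s *: 1]mulr1.
  rewrite (_ : _ - _ = s *: (h + (2 * t) *: y + s *: y)); first by rewrite scalerA mulVf// scale1r.
  by apply/rowP => i; rewrite !mxE; ring.
have cr : s^-1 *: (r (s *: (1 : R) + t) - r t) @[s --> 0^'] --> h + (2 * t) *: y.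
  apply/cvgrPdist_le => e e0; near=> s.
  rewrite rE; last by near: s; exact: nbhs_dnbhs_neq.
  rewrite opprD addrA subrr add0r normrN normrZ.
  have y0 : 0 < `|y| + 1 by rewrite ltr_wpDl.
  apply: (@le_trans _ _ (`|s| * (`|y| + 1))); first by rewrite ler_wpM2l// lerDl.
  rewrite -ler_pdivlMr// -[`|s|]normrN -sub0r; near: s.
  apply: nbhs_dnbhs. by apply: (@near_norm_le R R 0); rewrite divr_gt0.
have dr : derivable r t 1 by apply/cvg_ex; exists (h + (2 * t) *: y).
have Dr : 'D_1 r t = h + (2 * t) *: y by apply: cvg_lim.
have dr' : differentiable r t by exact/derivable1_diffP.
have dfr : differentiable (f \o r) t by exact: differentiable_comp.
split; first exact: diff_derivable.
by rewrite deriveE// diff_comp//= -deriveE// -Dr -gradientE// -deriveE.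
Unshelve. all: by end_near. Qed.

(** Freezes a curve outside [[0, 1]]: a quadratic curve is Lipschitz on bounded intervals only,
    while [lipschitz_density] wants a function Lipschitz on the whole line. *)
Definition clamp01 (t : R) : R := Num.max 0 (Num.min t 1).

Lemma clamp01_itv t : 0 <= clamp01 t <= 1.
Proof. by rewrite /clamp01 le_max lexx /= ge_max ler01 ge_min lexx orbT. Qed.

Lemma clamp01_id t : 0 <= t -> t <= 1 -> clamp01 t = t.
Proof. by move=> t0 t1; rewrite /clamp01 min_l// max_r. Qed.

Lemma clamp01_lip s t : `|clamp01 s - clamp01 t| <= `|s - t|.
Proof.
wlog st : s t / s <= t => [H|].
  by have [/H//|/ltW/H] := leP s t; rewrite distrC [leRHS]distrC.
rewrite [leRHS]distrC [leRHS]ger0_norm ?subr_ge0//.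
have h01 : (0 : R) < 1 by [].
rewrite ler_norml /clamp01 /Order.max /Order.min.
by apply/andP; split; case: (ltP s 1) => ?; case: (ltP t 1) => ?;
  case: (ltP 0 s) => ?; case: (ltP 0 t) => ?; rewrite ?h01; lra.
Qed.

Lemma curve_quad_lip (x0 h y : 'rV[R]_n) s t : 0 <= s <= 1 -> 0 <= t <= 1 ->
  `|curve x0 h (quad y) s - curve x0 h (quad y) t| <= (`|h| + 2 * `|y|) * `|s - t|.
Proof.
move=> /andP[s0 s1] /andP[t0 t1].
rewrite (_ : _ - _ = (s - t) *: h + ((s + t) * (s - t)) *: y); last first.
  by apply/rowP => i; rewrite !mxE; ring.
apply: (le_trans (ler_normD _ _)); rewrite !normrZ mulrDl mulrC lerD//.
rewrite mulrAC ler_wpM2r// ler_wpM2r// ger0_norm ?addr_ge0//.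
by move: s1 t1; lra.
Qed.

Lemma ae_neq (c : R) : {ae mu, forall t : R, t != c}.
Proof.
exists [set c]; split => //; first exact: lebesgue_measure_set1.
by move=> t /= /negP; rewrite negbK => /eqP.
Qed.

(** The clamped composite has a density that integrates to its increments, and almost everywhere
    this density and the chain rule compute the same derivative. *)
Lemma ftc_curve_quad (x0 h y : 'rV[R]_n) (a : R) :
  {ae mu, forall t : R, 0 < t -> differentiable f (curve x0 h (quad y) t)} ->
  0 <= a -> a <= 1 ->
  \int[mu]_(t in `[0, a])
     dot (gradient f (curve x0 h (quad y) t)) (h + (2 * t) *: y)
  = f (curve x0 h (quad y) a) - f x0.
Proof.
set r := curve x0 h (quad y) => dr a0 a1.
pose F t := f (r (clamp01 t)).
have L0 : 0 <= `|L| by [].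
have FL s t : `|F s - F t| <= (`|L| * (`|h| + 2 * `|y|)) * `|s - t|.
  apply: (le_trans (fL _ _)).
  apply: (@le_trans _ _ (`|L| * `|r (clamp01 s) - r (clamp01 t)|)).
    by rewrite ler_wpM2r// ler_norm.
  rewrite -mulrA ler_wpM2l//.
  apply: (le_trans (curve_quad_lip _ _ _ (clamp01_itv s) (clamp01_itv t))).
  by rewrite ler_wpM2l ?clamp01_lip// addr_ge0// mulr_ge0.
have [phi [iphi dphi Iphi]] := lipschitz_density FL.
have r0 : r 0 = x0 by rewrite /r /curve /quad expr0n !scale0r !addr0.
transitivity (F a - F 0); last by rewrite /F !clamp01_id ?r0.
rewrite -Iphi// /Rintegral; congr fine.
apply: ae_eq_integral => //.
- apply/measurable_EFinP; apply: measurable_dot; last first.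
    move=> i; rewrite (_ : (fun t => _) = (fun t : R => h ord0 i + (2 * t) * y ord0 i)).
      by apply: measurable_funD => //; apply: measurable_funM => //; apply: measurable_funM.
    by apply/funext => t; rewrite !mxE.
  by move=> i; apply: measurable_gradient; apply: measurable_curve; exact: measurable_quad.
- have /integrableP[mphi _] := iphi.
  apply: (measurable_funS _ _ mphi) => //.
  by move=> t /=; rewrite !in_itv/= => /andP[-> ta] /=; exact: le_trans ta a1.
have muF := ae_filter_ringOfSetsType mu.
(* The two endpoints are discarded: clamping is locally the identity only strictly between them. *)
apply: filterS3 (filterI dphi dr) (ae_neq 0) (ae_neq 1).
move=> t [{}dphi {}dr] t0 t1 /=; rewrite in_itv/= => /andP[t0' ta].
have t01 : 0 < t < 1.
  by rewrite !lt_neqAle t0' t1 (le_trans ta)// eq_sym t0.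
congr EFin; have {}dphi := dphi t01.
have /andP[tp tl1] := t01.
have dfr := is_derive_curve_quad (dr tp).
have dF : is_derive t 1 F (dot (gradient f (r t)) (h + (2 * t) *: y)).
  apply: (near_eq_is_derive _ dfr); near=> s.
  rewrite /F clamp01_id//; apply/ltW; near: s.
    exact: lt_nbhsr.
  exact: lt_nbhsl.
by rewrite -(@derive_val _ _ _ _ _ _ _ dphi) -(@derive_val _ _ _ _ _ _ _ dF).
Unshelve. all: by end_near. Qed.

Lemma itv_measure (a : R) : 0 <= a -> fine (mu (`[0, a]%classic : set R)) = a.
Proof.
move=> a0; rewrite lebesgue_measure_itv/= lte_fin.
by move: a0; rewrite le_eqVlt => /predU1P[<-|->]; rewrite ?ltxx//= oppr0 addr0.
Qed.

Lemma Rintegral_bound (g : R -> R) (a b c : R) : 0 <= a -> a <= b -> 0 <= c ->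
  mu.-integrable `[0, b] (EFin \o g) -> (forall t, t \in `[0, a] -> `|g t| <= c) ->
  `|\int[mu]_(t in `[0, a]) g t| <= c * a.
Proof.
move=> a0 ab c0 ig gc.
have ig' : mu.-integrable `[0, a] (EFin \o g).
  apply: integrableS ig => // t /=; rewrite !in_itv/= => /andP[-> ta].
  exact: le_trans ta ab.
apply: (le_trans (le_normr_Rintegral _ ig')) => //.
apply: (@le_trans _ _ (\int[mu]_(t in `[0, a]) c)).
  apply: le_Rintegral => //.
  - exact: (integrable_norm ig').
  - by apply: (@integrable_bounded (cst c) a c) => // t _; rewrite /= ger0_norm.
rewrite Rintegral_cst//.
have -> : fine (mu (`[0, a]%classic : set R)) = a by exact: itv_measure.
by [].
Qed.

Lemma gradient_norm x : `|gradient f x| <= `|L|.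
Proof.
by apply: norm_row_le => // i; apply: (le_trans (gradient_bound _ _)); exact: ler_norm.
Qed.

Lemma dot_gradient_integral (r : R -> 'rV[R]_n) a h : measurable_row r ->
  dot (gradient_integral f r a) h = \int[mu]_(t in `[0, a]) dot (gradient f (r t)) h.
Proof.
move=> mr; rewrite /dot Rintegral_sum//.
  apply: eq_bigr => i _; rewrite mxE RintegralZr//; exact: integrable_gradient.
move=> i; apply: (@integrable_bounded _ _ (L * `|h ord0 i|)).
  by apply: measurable_funM => //; exact: measurable_gradient.
by move=> t _; rewrite normrM ler_wpM2r// gradient_bound.
Qed.

(** The velocity of the curve is [h + 2 t y], so the error is the average of the gradient against
    [2 t y]; the factor [n] comes from bounding [dot] by sup norms. *)
Lemma average_gradient (x0 h y : 'rV[R]_n) (a : R) :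
  {ae mu, forall t : R, 0 < t -> differentiable f (curve x0 h (quad y) t)} ->
  0 < a -> a <= 1 ->
  `|dot (a^-1 *: gradient_integral f (curve x0 h (quad y)) a) h
    - a^-1 * (f (curve x0 h (quad y) a) - f x0)| <= n%:R * `|L| * (2 * a * `|y|).
Proof.
move=> dr a0 a1; rewrite dotZl -mulrBr normrM normfV (gtr0_norm a0).
rewrite ler_pdivrMl// [leRHS]mulrC.
set r := curve x0 h (quad y).
have mr : measurable_row r by apply: measurable_curve; exact: measurable_quad.
have m2y : measurable_row (fun t : R => (2 * t) *: y).
  move=> i; rewrite (_ : (fun t => _) = (fun t : R => (2 * t) * y ord0 i)).
    by apply: measurable_funM => //; apply: measurable_funM.
  by apply/funext => t; rewrite !mxE.
have b2y t : t \in `[0, a] -> `|dot (gradient f (r t)) ((2 * t) *: y)| <=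
     n%:R * `|L| * (2 * a * `|y|).
  rewrite in_itv/= => /andP[t0 ta]; apply: (le_trans (dot_le _ _)).
  apply: ler_pM => //.
    by rewrite ler_wpM2l//; exact: gradient_norm.
  by rewrite normrZ ler_wpM2r// normrM !ger0_norm// ler_wpM2l.
have mg : measurable_row (fun t => gradient f (r t)).
  by move=> i; exact: measurable_gradient.
have i2y : mu.-integrable `[0, a] (EFin \o (fun t => dot (gradient f (r t)) ((2 * t) *: y))).
  by apply: integrable_bounded b2y; exact: measurable_dot.
have ih : mu.-integrable `[0, a] (EFin \o (fun t => dot (gradient f (r t)) h)).
  apply: (@integrable_bounded _ _ (n%:R * `|L| * `|h|)).
    by apply: measurable_dot => // i; exact: measurable_cst.
  move=> t _; apply: (le_trans (dot_le _ _)); rewrite ler_wpM2r// ler_wpM2l//.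
  exact: gradient_norm.
rewrite dot_gradient_integral// -(ftc_curve_quad dr (ltW a0) a1).
under [X in _ - X]eq_Rintegral do rewrite dotDr.
rewrite RintegralD// opprD addrA subrr add0r normrN.
by apply: (@Rintegral_bound _ a a) => //; [exact: ltW|rewrite !mulr_ge0// ltW].
Qed.

End gradient_integrals.

(** * Patched curves *)

Lemma is_derive_ext {R : realType} {V W : normedModType R} (x v : V) (f g : V -> W)
  (df dg : W) : f =1 g -> df = dg -> is_derive x v f df -> is_derive x v g dg.
Proof. by move=> /funext -> ->. Qed.

Section spline.
Context {R : realType}.
Implicit Types b s t x : R.

Definition pos_sqr x : R := Num.max 0 x ^+ 2.

Lemma is_derive_pos_sqr x : is_derive x (1 : R) pos_sqr (2 * Num.max 0 x).
Proof.
apply/is_derive_eps => e e0; exists e => // h he; rewrite [h *: 1]mulr1.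
apply: (@le_trans _ _ (`|h| * `|h|)); last by rewrite ler_wpM2r.
rewrite -normrM /pos_sqr [`|h * h|]ger0_norm -?expr2 ?sqr_ge0// ler_norml.
by apply/andP; split; case: (leP 0 x) => ?; case: (leP 0 (x + h)) => ?; nra.
Qed.

(* Quadratic spline of class C^1, vanishing up to [b / 2] and equal to the
   identity from [b] on. *)
Definition ramp b t : R :=
  (7 * pos_sqr (t - b / 2) - 12 * pos_sqr (t - b * 3 / 4) + 5 * pos_sqr (t - b)) / b.

Definition dramp b t : R :=
  (14 * Num.max 0 (t - b / 2) - 24 * Num.max 0 (t - b * 3 / 4) + 10 * Num.max 0 (t - b)) / b.

Lemma is_derive_ramp b t : is_derive t (1 : R) (ramp b) (dramp b t).
Proof.
have dp c : is_derive t (1 : R) (fun s => pos_sqr (s - c)) (2 * Num.max 0 (t - c)).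
  apply/is_derive_eps => e e0.
  have [d d0 dP] := (is_derive_eps _ _ _ _).1 (is_derive_pos_sqr (t - c)) e e0.
  exists d => // h hd.
  by rewrite (_ : t + _ - c = t - c + h *: 1); [exact: dP|rewrite addrAC].
have D := is_deriveZ b^-1 (is_deriveD (is_deriveB (is_deriveZ 7 (dp (b / 2)))
  (is_deriveZ 12 (dp (b * 3 / 4)))) (is_deriveZ 5 (dp b))).
apply: is_derive_ext D => [s|]; last by rewrite /dramp /GRing.scale /=; ring.
rewrite /ramp [RHS]mulrC -[LHS]/(b^-1 * (7 * pos_sqr (s - b / 2)
  - 12 * pos_sqr (s - b * 3 / 4) + 5 * pos_sqr (s - b))).
by [].
Qed.

Lemma ramp0 b t : 0 < b -> t <= b / 2 -> ramp b t = 0.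
Proof.
move=> b0 tb; rewrite /ramp /pos_sqr !max_l; [by rewrite expr0n !mulr0 subrr addr0 mul0r|lra..].
Qed.

(** The coefficients 7, -12, 5 solve three linear equations: past the last knot the terms in [t^2]
    and the constants cancel, and [b * t] remains before the division by [b]. *)
Lemma ramp_id b t : 0 < b -> b <= t -> ramp b t = t.
Proof.
move=> b0 tb; rewrite /ramp /pos_sqr !max_r; [|lra..].
by field; rewrite gt_eqF.
Qed.

Lemma ramp_bound b t : 0 < b -> 0 <= t -> `|ramp b t| <= 4 * t.
Proof.
move=> b0 t0; rewrite /ramp normrM normfV (gtr0_norm b0) ler_pdivrMr// /pos_sqr.
rewrite ler_norml; apply/andP; split;
  case: (leP 0 (t - b / 2)) => ?; case: (leP 0 (t - b * 3 / 4)) => ?;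
  case: (leP 0 (t - b)) => ?; nra.
Qed.

(** The slope is piecewise linear with values 0, 7/2, 1 at the knots, whatever [b] is; this keeps
    the velocities of the patched curves bounded as the turning scales shrink. *)
Lemma dramp_bound b t : 0 < b -> `|dramp b t| <= 4.
Proof.
move=> b0; rewrite /dramp normrM normfV (gtr0_norm b0) ler_pdivrMr//.
rewrite ler_norml; apply/andP; split;
  case: (leP 0 (t - b / 2)) => ?; case: (leP 0 (t - b * 3 / 4)) => ?;
  case: (leP 0 (t - b)) => ?; lra.
Qed.

Lemma dramp0 b t : 0 < b -> t <= b / 2 -> dramp b t = 0.
Proof.
by move=> b0 tb; rewrite /dramp !max_l; [rewrite !mulr0 subrr addr0 mul0r|lra..].
Qed.

Lemma dramp_id b t : 0 < b -> b <= t -> dramp b t = 1.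
Proof.
move=> b0 tb; rewrite /dramp !max_r; [|lra..].
by field; rewrite gt_eqF.
Qed.

(** Each truncation is 1-Lipschitz, and 48 = 14 + 24 + 10. *)
Lemma dramp_lip b s t : 0 < b -> `|dramp b s - dramp b t| <= 48 / b * `|s - t|.
Proof.
move=> b0; rewrite /dramp -mulrBl normrM normfV (gtr0_norm b0) [leRHS]mulrAC ler_wpM2r ?invr_ge0 ?(ltW b0)//.
have ml c : - `|s - t| <= Num.max 0 (s - c) - Num.max 0 (t - c) <= `|s - t|.
  case: (ger0P (s - t)) => ?; apply/andP; split;
    by case: (leP 0 (s - c)) => ?; case: (leP 0 (t - c)) => ?; lra.
have /andP[l1 r1] := ml (b / 2); have /andP[l2 r2] := ml (b * 3 / 4).
by have /andP[l3 r3] := ml b; rewrite ler_norml; apply/andP; split; lra.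
Qed.

Lemma measurable_ramp b : measurable_fun setT (ramp b).
Proof.
apply: continuous_measurable_fun => t.
have [d _] := is_derive_ramp b t.
by apply: differentiable_continuous; exact/derivable1_diffP.
Qed.

End spline.

(** * The patched curve, its derivative and its tangent at 0 *)

Section patched_curve.
Context {R : realType} {n : nat} (h : nat -> 'rV[R]_n) (a b : nat -> R) (g y : 'rV[R]_n).
Hypotheses (b0 : forall k, 0 < b k) (ba : forall k, b k <= a k)
  (ab : forall k, a k.+1 <= b k / 2) (ainv : forall k, a k <= k.+1%:R^-1)
  (hg : h k @[k --> \oo] --> g).
Implicit Types (s t e : R) (N M k : nat).

(** Follows direction [v] up to [c / 2] and direction [u] from [c] on. As only [u], [v] and [c]
    enter, rational directions and scales [1 / (l + 1)] give countably many pieces. *)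
Definition bend (u v : 'rV[R]_n) (c t : R) : 'rV[R]_n := t *: u + (ramp c t - t) *: (u - v).

Definition dbend (u v : 'rV[R]_n) (c t : R) : 'rV[R]_n := u + (dramp c t - 1) *: (u - v).

(* On [[b k, a k]] with [k <= N] the curve [bends N] is the segment [t *: h k],
   and on [[a k.+1, b k]] it turns from direction [h k.+1] to [h k]. *)
Fixpoint bends N t : 'rV[R]_n :=
  if N is M.+1 then bends M t + (ramp (b M) t - t) *: (h M - h N) else t *: h 0%N.

Fixpoint dbends N t : 'rV[R]_n :=
  if N is M.+1 then dbends M t + (dramp (b M) t - 1) *: (h M - h N) else h 0%N.

Lemma a_gt0 k : 0 < a k. Proof. exact: lt_le_trans (b0 k) (ba k). Qed.

Lemma b_decr k : b k.+1 <= b k / 2.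
Proof. exact: le_trans (ba _) (ab _). Qed.

Lemma b_mono N M : (N <= M)%N -> b M <= b N.
Proof.
elim: M => [|M IH]; first by rewrite leqn0 => /eqP ->.
rewrite leq_eqVlt => /orP[/eqP->//|]; rewrite ltnS => /IH; apply: le_trans.
by have := b_decr M; have := b0 M; lra.
Qed.

Lemma a_mono N M : (N <= M)%N -> a M <= a N.
Proof.
elim: M => [|M IH]; first by rewrite leqn0 => /eqP ->.
rewrite leq_eqVlt => /orP[/eqP->//|]; rewrite ltnS => /IH; apply: le_trans.
by have := ab M; have := b0 M; have := ba M; lra.
Qed.

(** The correction added at stage [M] vanishes from [b M] on, so later stages only change the curve
    closer to 0. *)
Lemma bends_stable N M t : b N <= t -> (N <= M)%N ->
  bends M t = bends N t /\ dbends M t = dbends N t.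
Proof.
move=> bt; elim: M => [|M IH]; first by rewrite leqn0 => /eqP ->.
rewrite leq_eqVlt => /orP[/eqP->//|]; rewrite ltnS => NM.
have [<- <-] := IH NM; have bMt : b M <= t by exact: le_trans (b_mono NM) bt.
by rewrite /= ramp_id// dramp_id// !subrr !scale0r !addr0.
Qed.

Lemma bends_eq N M t : b N <= t -> b M <= t ->
  bends M t = bends N t /\ dbends M t = dbends N t.
Proof.
move=> bN bM; have [NM|MN] := leP N M; first exact: bends_stable.
by have [-> ->] := bends_stable bM (ltW MN).
Qed.

(** Below [a k] all earlier ramps are 0, and the corrections [- t *: (h j - h j.+1)] telescope. *)
Lemma bends_small k t : t <= a k -> bends k t = t *: h k /\ dbends k t = h k.
Proof.
elim: k => [//|k IH] tk.
have tb : t <= b k / 2 by exact: le_trans tk (ab k).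
rewrite /=; have [-> ->] : bends k t = t *: h k /\ dbends k t = h k.
  by apply: IH; have := b0 k; have := ba k; lra.
rewrite ramp0// dramp0// !sub0r scaleNr scaleN1r scalerBr.
by split; apply/rowP => i; rewrite !mxE; ring.
Qed.

Definition idx t : nat := Num.truncn t^-1.

Lemma b_idx t : 0 < t -> b (idx t) < t.
Proof.
move=> t0; apply: (le_lt_trans (ba _)); apply: (le_lt_trans (ainv _)).
by rewrite invf_plt ?posrE// truncnS_gt.
Qed.

(** The remainder [o] of a curve with tangent [g]: the limit of the stages, already attained at
    stage [idx t], minus [t *: g], plus the generic perturbation. *)
Definition patch t : 'rV[R]_n :=
  if t <= 0 then 0 else bends (idx t) t - t *: g + t ^+ 2 *: y.

Definition dpatch t : 'rV[R]_n :=
  if t <= 0 then 0 else dbends (idx t) t - g + (2 * t) *: y.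

Lemma patchE N t : 0 < t -> b N <= t ->
  patch t = bends N t - t *: g + t ^+ 2 *: y /\ dpatch t = dbends N t - g + (2 * t) *: y.
Proof.
move=> t0 bN; rewrite /patch /dpatch leNgt t0 /=.
by have [-> ->] := bends_eq bN (ltW (b_idx t0)).
Qed.

Lemma bends_bend k t : t <= a k ->
  bends k.+1 t = bend (h k) (h k.+1) (b k) t /\
  dbends k.+1 t = dbend (h k) (h k.+1) (b k) t.
Proof. by move=> /bends_small[/= -> ->]. Qed.

Lemma patch_bend k t : 0 < t -> a k.+1 <= t -> t <= a k ->
  patch t = bend (h k) (h k.+1) (b k) t - t *: g + t ^+ 2 *: y /\
  dpatch t = dbend (h k) (h k.+1) (b k) t - g + (2 * t) *: y.
Proof.
move=> t0 at1 ta; have [-> ->] := patchE t0 (le_trans (ba _) at1).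
by have [-> ->] := bends_bend ta.
Qed.

Lemma patch_straight k t : b k <= t -> t <= a k ->
  patch t = t *: h k - t *: g + t ^+ 2 *: y.
Proof.
move=> bt ta; have [-> _] := patchE (lt_le_trans (b0 k) bt) bt.
by have [-> _] := bends_small ta.
Qed.

Lemma scale_index t N : 0 < t -> t < a N ->
  exists k, [/\ (N <= k)%N, a k.+1 <= t & t <= a k].
Proof.
move=> t0 tN; have ex : exists k, a k.+1 <= t.
  have [m mt] := inv_nat_lt t0; exists m.
  by apply: le_trans (a_mono (leqnSn m)) _; exact: le_trans (ainv m) (ltW mt).
have [k kt kmin] := ex_minnP ex; exists k; split => //.
  rewrite leqNgt; apply/negP => /a_mono akN.
  by have := le_lt_trans (le_trans akN kt) tN; rewrite ltxx.
case: k kt kmin => [|k] kt kmin.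
  by apply: ltW; apply: lt_le_trans tN (a_mono (leq0n N)).
by rewrite leNgt; apply/negP => /ltW /kmin; rewrite ltnn.
Qed.

(** Close to 0 the two directions in use are both near [g], and the bounds on the ramp and its slope
    do not depend on [b k]. This yields both the [o(t)] condition and the continuity of the
    derivative at 0. *)
Lemma patch_small e : 0 < e -> exists2 d : R, 0 < d & forall t, 0 < t -> t < d ->
  `|patch t| <= e * t /\ `|dpatch t| <= e.
Proof.
(* The velocity bound adds up to [11 * eta]: 1 for [g - h k.+1], 4 times 2 for the turn, 2 for the
   perturbation. *)
move=> e0; pose eta := e / 11; have eta0 : 0 < eta by rewrite divr_gt0.
have /cvgrPdist_le/(_ _ eta0) [K _ KP] := hg.
exists (Num.min (a K) (eta / (`|y| + 1))).
  by rewrite lt_min a_gt0 divr_gt0// ltr_wpDl.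
move=> t t0; rewrite lt_min => /andP[tK ty].
have [k [Kk at1 ta]] := scale_index t0 tK.
have [-> ->] := patch_bend t0 at1 ta.
have h1 := KP k Kk; have h2 := KP k.+1 (leq_trans Kk (leqnSn k)).
have h12 : `|h k - h k.+1| <= 2 * eta.
  rewrite (_ : _ - _ = (g - h k.+1) - (g - h k)).
    by apply: (le_trans (ler_normB _ _)); move: h1 h2; rewrite /=; lra.
  by apply/rowP => i; rewrite !mxE; ring.
have yt : t * `|y| <= eta.
  apply: (@le_trans _ _ (t * (`|y| + 1))); first by rewrite ler_wpM2l ?lerDl// ltW.
  by rewrite -ler_pdivlMr ?ltr_wpDl// ltW.
split.
- rewrite (_ : _ + _ = - (t *: (g - h k.+1)) + (ramp (b k) t *: (h k - h k.+1)) + t ^+ 2 *: y); last first.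
    by apply/rowP => i; rewrite !mxE; ring.
  apply: (le_trans (ler_normD _ _)); apply: (le_trans (lerD (ler_normD _ _) (lexx _))).
  have r1 := ler_pM (normr_ge0 _) (normr_ge0 _) (ramp_bound (b0 k) (ltW t0)) h12.
  move: (ramp _ _) r1 => rt r1; rewrite normrN !normrZ (gtr0_norm t0).
  have r2 := ler_wpM2l (ltW t0) h2.
  have r3 := ler_wpM2l (ltW t0) yt.
  apply: (le_trans (lerD (lerD r2 r1) (_ : _ <= t * eta))); first by rewrite -mulrA.
  by rewrite /eta; move: (t) t0 e0 => t' ? ?; nra.
- rewrite (_ : _ + _ = - (g - h k.+1) + (dramp (b k) t *: (h k - h k.+1)) + (2 * t) *: y); last first.
    by apply/rowP => i; rewrite !mxE; ring.
  apply: (le_trans (ler_normD _ _)); apply: (le_trans (lerD (ler_normD _ _) (lexx _))).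
  have r1 := ler_pM (normr_ge0 _) (normr_ge0 _) (dramp_bound t (b0 k)) h12.
  move: (dramp _ _) r1 => rt r1; rewrite normrN !normrZ.
  have r3 : `|2 : R| * `|t| * `|y| <= 2 * eta by rewrite !gtr0_norm// -mulrA ler_wpM2l.
  apply: (le_trans (lerD (lerD h2 r1) r3)).
  by rewrite /eta; lra.
Qed.

Lemma is_derive_bends N t i :
  is_derive t (1 : R) (fun s => bends N s ord0 i) (dbends N t ord0 i).
Proof.
elim: N => [|N IH] /=.
  apply: is_derive_ext (is_deriveZ (h 0%N ord0 i) (is_derive_id t (1 : R))).
    by move=> s; rewrite !mxE mulrC.
  by rewrite /GRing.scale /= mulr1.
pose u := (h N - h N.+1) ord0 i.
have D := is_deriveD IH (is_deriveZ u (is_deriveB (is_derive_ramp (b N) t) (is_derive_id t (1 : R)))).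
by apply: is_derive_ext D => [s|];
  rewrite [RHS]mxE [X in _ = _ + X]mxE -/u [X in _ = _ + X]mulrC.
Qed.

Lemma is_derive_patch t i : 0 < t ->
  is_derive t (1 : R) (fun s => patch s ord0 i) (dpatch t ord0 i).
Proof.
move=> t0; have bt := b_idx t0.
have [_ dE] := patchE t0 (ltW bt).
have D := is_deriveD (is_deriveB (is_derive_bends (idx t) t i)
  (is_deriveZ (g ord0 i) (is_derive_id t (1 : R))))
  (is_deriveZ (y ord0 i) (is_deriveX 2 (is_derive_id t (1 : R)))).
apply: (near_eq_is_derive _ (is_derive_ext _ _ D)); last 2 first.
- move=> s; exact: erefl.
- by rewrite dE !mxE /GRing.scale /= expr1 mulr1 mulr1; ring.
near=> s.
have s0 : 0 < s by near: s; exact: lt_nbhsr.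
have bs : b (idx t) <= s by apply/ltW; near: s; exact: lt_nbhsr.
have [-> _] := patchE s0 bs.
rewrite !mxE -[LHS]/(bends (idx t) s ord0 i - g ord0 i * s + y ord0 i * (s ^+ 2)).
by ring.
Unshelve. all: by end_near. Qed.

Lemma dbends_lip N : exists C, forall s t, `|dbends N s - dbends N t| <= C * `|s - t|.
Proof.
elim: N => [|N [C CP]]; first by exists 0 => s t /=; rewrite subrr normr0 mul0r.
exists (C + 48 / b N * `|h N - h N.+1|) => s t /=.
rewrite (_ : _ - _ = (dbends N s - dbends N t) +
    (dramp (b N) s - dramp (b N) t) *: (h N - h N.+1)); last first.
  by apply/rowP => i; rewrite !mxE; ring.
apply: (le_trans (ler_normD _ _)); rewrite mulrDl lerD//.
have := dramp_lip s t (b0 N); move: (dramp _ s) (dramp _ t) => u v uv.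
by rewrite normrZ mulrAC ler_wpM2r.
Qed.

Lemma dpatch_continuous : continuous dpatch.
Proof.
suff near_dpatch t e : 0 < e -> \forall s \near t, `|dpatch t - dpatch s| <= e.
  by move=> t; apply/cvgrPdist_le => e e0; exact: near_dpatch.
move=> e0; have [t0|t0|t0] := ltgtP t 0.
- near=> s; rewrite /dpatch (ltW t0) ifT ?subrr ?normr0 ?(ltW e0)//.
  by apply/ltW; near: s; exact: lt_nbhsl.
- have [C CP] := dbends_lip (idx t); have bt := b_idx t0.
  have C0 : 0 < `|C| + 2 * `|y| + 1 by rewrite ltr_wpDl// addr_ge0// mulr_ge0.
  near=> s.
  have s0 : 0 < s by near: s; exact: lt_nbhsr.
  have bs : b (idx t) <= s by apply/ltW; near: s; exact: lt_nbhsr.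
  have [_ ->] := patchE s0 bs; have [_ ->] := patchE t0 (ltW bt).
  rewrite (_ : _ - _ = (dbends (idx t) t - dbends (idx t) s) + (t - s) *: (2 *: y)); last first.
    by apply/rowP => i; rewrite !mxE; ring.
  apply: (le_trans (ler_normD _ _)); rewrite !normrZ (gtr0_norm (ltr0n R 2)).
  apply: (@le_trans _ _ ((`|C| + 2 * `|y| + 1) * `|t - s|)).
    have cp : `|dbends (idx t) t - dbends (idx t) s| <= `|C| * `|t - s|.
      by apply: (le_trans (CP _ _)); rewrite ler_wpM2r// ler_norm.
    by have := normr_ge0 (t - s); move: cp; lra.
  rewrite -ler_pdivlMl//; near: s; apply: near_real_le.
  by rewrite mulr_gt0// invr_gt0.
- have [d d0 dP] := patch_small e0; near=> s.
  rewrite {1}/dpatch t0 lexx sub0r normrN.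
  have [s0|s0] := leP s 0; first by rewrite /dpatch s0 normr0 ltW.
  by apply: (dP s _ _).2 => //; near: s; apply: lt_nbhsl; rewrite t0.
Unshelve. all: by end_near. Qed.

(** The limit is two-sided even at 0, because [patch] is 0 on the negative side; the one-sided
    quotients follow by restriction. *)
Lemma patch_diff_quotient t : 0 <= t ->
  (s - t)^-1 *: (patch s - patch t) @[s --> t^'] --> dpatch t.
Proof.
rewrite le_eqVlt => /predU1P[<-|t0]; apply/cvgrPdist_le => e e0.
  have [d d0 dP] := patch_small e0; near=> s.
  have s0 : s != 0 by near: s; exact: nbhs_dnbhs_neq.
  have p0 : patch 0 = 0 by rewrite /patch lexx.
  rewrite /dpatch lexx sub0r normrN p0 !subr0 normrZ normfV.
  rewrite ler_pdivrMl ?normr_gt0// mulrC.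
  have [s0'|s0'] := leP s 0; first by rewrite /patch s0' normr0 mulr_ge0// ltW.
  rewrite (gtr0_norm s0'); apply: (dP s _ _).1 => //.
  by near: s; apply: nbhs_dnbhs; exact: lt_nbhsl.
have near_i i : \forall s \near t,
    `|patch s ord0 i - patch t ord0 i - dpatch t ord0 i * (s - t)| <= e * `|s - t|.
  have [d d0 dP] := (is_derive_eps _ _ _ _).1 (is_derive_patch i t0) e e0.
  near=> s; have := dP (s - t); rewrite [(s - t) *: 1]mulr1 (addrC t) subrK; apply.
  by rewrite distrC; near: s; exact: near_real_le.
have {}near_i := filter_forall _ near_i.
near=> s.
have st : s != t by near: s; exact: nbhs_dnbhs_neq.
have st' : 0 < `|s - t| by rewrite normr_gt0 subr_eq0.
apply: norm_row_le => [|i]; first exact: ltW.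
rewrite -(ler_pM2r st') -normrM !mxE -normrN.
rewrite (_ : - (_ * (s - t)) = patch s ord0 i - patch t ord0 i - dpatch t ord0 i * (s - t)); last first.
  by field; rewrite subr_eq0.
by move: i; near: s; apply: nbhs_dnbhs; exact: near_i.
Unshelve. all: by end_near. Qed.

Lemma measurable_bends N : measurable_row (bends N).
Proof.
elim: N => [|N IH] i /=.
  rewrite (_ : (fun t => _) = (fun t : R => t * h 0%N ord0 i)).
    by apply: measurable_funM.
  by apply/funext => t; rewrite !mxE.
rewrite (_ : (fun t => _) = (fun t : R => bends N t ord0 i + (ramp (b N) t - t) * (h N - h N.+1) ord0 i)).
  apply: measurable_funD => //; apply: measurable_funM => //; apply: measurable_funB => //.
  exact: measurable_ramp.
by apply/funext => t; rewrite [LHS]mxE [X in _ + X]mxE.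
Qed.

(** The stage [idx t] varies with [t], but at each [t > 0] the stages are eventually constant, so
    [patch] is a pointwise limit of measurable maps. *)
Lemma measurable_patch : measurable_row patch.
Proof.
move=> i.
have mI : measurable (`]-oo, 0]%classic : set R) by exact: measurable_itv.
rewrite -(setUv (`]-oo, 0]%classic : set R)); apply/measurable_funU => //; first exact: measurableC.
split.
  apply: (@eq_measurable_fun _ _ _ _ _ (cst (0 : R))) => // t.
  by rewrite inE /= in_itv/= /patch => ->; rewrite mxE.
apply: (@measurable_fun_cvg _ _ _ _ (fun N t => bends N t ord0 i - t * g ord0 i + t ^+ 2 * y ord0 i)).
  move=> N; apply: measurable_funTS; apply: measurable_funD.
    by apply: measurable_funB; [exact: measurable_bends|apply: measurable_funM].
  by apply: measurable_funM => //; exact: measurable_funX.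
move=> t /=; rewrite in_itv/= => /negP; rewrite -ltNge => t0.
apply: cvg_near_cst; near=> N.
have bt := b_idx t0.
have NN : (idx t <= N)%N by near: N; exact: nbhs_infty_ge.
have [-> _] := patchE t0 (le_trans (b_mono NN) (ltW bt)).
by rewrite !mxE.
Unshelve. all: by end_near. Qed.

End patched_curve.

(** * Limits of averages realised by a patched curve *)

Section patch_cluster.
Context {R : realType} {n : nat} (f : 'rV[R]_n -> R) (L : R).
Hypothesis fL : forall x y, `|f x - f y| <= L * `|x - y|.
Variables (x0 : 'rV[R]_n) (h : nat -> 'rV[R]_n) (a b : nat -> R) (g y : 'rV[R]_n).
Hypotheses (b0 : forall k, 0 < b k) (ba : forall k, b k <= a k)
  (ab : forall k, a k.+1 <= b k / 2) (ainv : forall k, a k <= k.+1%:R^-1)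
  (hg : h k @[k --> \oo] --> g) (g1 : enorm g = 1).
Notation mu := (@lebesgue_measure R).
Hypothesis fdiff : forall k, {ae mu, forall t : R, 0 < t ->
  differentiable f (x0 + bend (h k) (h k.+1) (b k) t + t ^+ 2 *: y)}.

Let o := patch h b g y.

Let small := patch_small y b0 ba ab ainv hg.

Lemma patch_differentiable a0 : a0 < a 0%N ->
  {ae mu, forall t : R, t \in `[0, a0] -> differentiable f (curve x0 g o t)}.
Proof.
move=> a0a.
have muF := ae_filter_ringOfSetsType mu.
apply: filterS2 (ae_foralln fdiff) (ae_neq 0) => t dt t0.
rewrite in_itv/= => /andP[t0' ta].
have {t0 t0'} t0 : 0 < t by rewrite lt_neqAle eq_sym t0.
have [k [_ at1 tk]] := scale_index b0 ba ab ainv t0 (le_lt_trans ta a0a).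
rewrite /curve /o; have [-> _] := patch_bend h g y b0 ba ab ainv t0 at1 tk.
have := dt k t0; congr (differentiable f _).
by apply/rowP => i; rewrite !mxE; ring.
Qed.

Lemma patch_eta : eta f x0 (g, o).
Proof.
have [d d0 dP] := small ltr01.
(* Below [d] the velocity of the remainder has sup norm at most 1; below [a 0] every positive time
   lies on one of the pieces. *)
pose a0 := Num.min d (a 0%N) / 2.
have m0 : 0 < Num.min d (a 0%N) by rewrite lt_min d0 (a_gt0 b0 ba).
have a0m : a0 < Num.min d (a 0%N) by rewrite /a0; lra.
have a0d : a0 < d by apply: lt_le_trans a0m _; rewrite ge_min lexx.
have a0a : a0 < a 0%N by apply: lt_le_trans a0m _; rewrite ge_min lexx orbT.
(* A singleton family suffices, so the uniform bounds concern this curve alone. *)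
exists a0, [set (g, o)]; split => //; split.
- by rewrite divr_gt0.
- by move=> g' o' [-> _].
- move=> e e0.
  have [d' d'0 d'P] := small (divr_gt0 e0 (ltr0Sn R n)).
  exists d' => // g' o' [_ ->] t t0 td' _.
  apply: (le_trans (enorm_le _)); rewrite normrZ normfV (gtr0_norm t0).
  rewrite mulrCA ler_pdivrMl//.
  apply: (le_trans (ler_wpM2l _ (d'P t t0 td').1)) => //.
  rewrite mulrA [leRHS]mulrC ler_wpM2r ?(ltW t0)// mulrCA ger_pMr//.
  by rewrite ler_pdivrMr// mul1r ler_nat.
- exists n%:R => g' o' [_ ->]; exists (dpatch h b g y); split.
  + move=> t; rewrite in_itv/= => /andP[t0 _].
    apply: cvg_within_filter.
    exact: (patch_diff_quotient b0 ba ab ainv hg t0).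
  + by apply: continuous_subspaceT; exact: dpatch_continuous.
  + move=> t; rewrite in_itv/= => /andP[t0 ta].
    apply: (le_trans (enorm_le _)); apply: ler_piMr => //.
    exact: (dP t t0 (lt_trans ta a0d)).2.
- by move=> g' o' [-> ->]; exact: patch_differentiable.
Qed.

(** The two curves coincide on [[b k, a k]]; on [[0, b k]], a share of at most [1 / (k + 1)], the
    integrands differ by at most [2 |L|]. *)
Lemma patch_average k : b k <= a k / k.+1%:R ->
  `|(a k)^-1 *: gradient_integral f (curve x0 g o) (a k) -
    (a k)^-1 *: gradient_integral f (curve x0 (h k) (quad y)) (a k)| <= 2 * `|L| / k.+1%:R.
Proof.
move=> bak; have ak := a_gt0 b0 ba k.
rewrite -scalerBr normrZ gtr0_norm ?invr_gt0// ler_pdivrMl//.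
apply: norm_row_le => [|i]; first by rewrite mulr_ge0 ?(ltW ak)// divr_ge0// mulr_ge0.
rewrite !mxE.
have mo : measurable_row (curve x0 g o).
  by apply: measurable_curve; exact: (measurable_patch h g y b0 ba ab ainv).
have mq : measurable_row (curve x0 (h k) (quad y)).
  by apply: measurable_curve; exact: measurable_quad.
have io := integrable_gradient fL (a k) i mo.
have iq := integrable_gradient fL (a k) i mq.
rewrite -RintegralB//.
set d := fun t => _ - _.
have id : mu.-integrable `[0, a k] (EFin \o d).
  have : mu.-integrable `[0, a k] ((EFin \o (fun t => gradient f (curve x0 g o t) ord0 i)) \-
     (EFin \o (fun t => gradient f (curve x0 (h k) (quad y) t) ord0 i)))%E.
    by apply: integrableB.
  by [].
have d0 t : t \in `]b k, a k] -> d t = 0.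
  rewrite in_itv/= => /andP[bt ta].
  rewrite /d /curve /o (patch_straight h g y b0 ba ab ainv (ltW bt) ta).
  rewrite (_ : x0 + t *: g + (t *: h k - t *: g + t ^+ 2 *: y) = x0 + t *: h k + quad y t) ?subrr//.
  by apply/rowP => j; rewrite !mxE; ring.
have -> : \int[mu]_(t in `[0, a k]) d t = \int[mu]_(t in `[0, b k]) d t.
  apply/eqP; rewrite -subr_eq0; apply/eqP.
  rewrite (@Rintegral_itvB R d (BLeft 0) (BRight (a k)) (b k))//; [|by rewrite bnd_simp ltW|by rewrite bnd_simp ba].
  rewrite (@eq_Rintegral _ _ _ _ _ (cst 0)).
    by rewrite Rintegral_cst// mul0r.
  by move=> t; rewrite inE => /d0.
apply: (le_trans (Rintegral_bound (c := 2 * `|L|) (ltW (b0 k)) (ba k) _ id _)) => //.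
- move=> t _; apply: (le_trans (ler_normB _ _)); rewrite mulr2n mulrDl mul1r.
  by rewrite lerD// (le_trans (gradient_bound fL _ _))// ler_norm.
- by rewrite [leRHS]mulrCA ler_wpM2l// mulr_ge0.
Qed.

Lemma patch_Ef v : (forall k, b k <= a k / k.+1%:R) ->
  (a k)^-1 *: gradient_integral f (curve x0 (h k) (quad y)) (a k) @[k --> \oo] --> v ->
  Ef f x0 v.
Proof.
move=> bak hv; exists a, g, o; split.
- exact: patch_eta.
- by move=> k; exact: (a_gt0 b0 ba).
- apply: (@squeeze_cvgr _ _ _ _ (cst 0) (fun k => k.+1%:R^-1)).
  + by near=> k; rewrite /= (ltW (a_gt0 b0 ba k)) ainv.
  + exact: cvg_cst.
  + exact: cvg_harmonic.
- apply/cvgrPdist_le => e e0.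
  have c0 : 0 < 2 * `|L| + 1 by rewrite ltr_wpDl// mulr_ge0.
  move/cvgrPdist_le : hv => /(_ _ (divr_gt0 e0 (ltr0Sn R 1))) hv.
  have tri (p q : 'rV[R]_n) : `|v - p| <= e / 2 -> `|q - p| <= e / 2 -> `|v - q| <= e.
    move=> vp qp; rewrite (_ : v - q = (v - p) - (q - p)).
      by rewrite (le_trans (ler_normB _ _))// [e]splitr lerD.
    by apply/rowP => i; rewrite !mxE; ring.
  near=> k.
  have h1 : `|v - (a k)^-1 *: gradient_integral f (curve x0 (h k) (quad y)) (a k)| <= e / 2.
    by near: k.
  have h2 := patch_average (bak k).
  have h3 : 2 * `|L| / k.+1%:R <= e / 2.
    apply: (@le_trans _ _ ((2 * `|L| + 1) * k.+1%:R^-1)).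
      by rewrite ler_wpM2r ?invr_ge0// lerDl.
    rewrite -ler_pdivlMl// mulrC; apply/ltW; near: k.
    exact: near_infty_natSinv_lt (PosNum (divr_gt0 (divr_gt0 e0 (ltr0Sn R 1)) c0)).
  exact: (tri _ _ h1 (le_trans h2 h3)).
Unshelve. all: by end_near. Qed.

End patch_cluster.

(** * Zero in a convex hull *)

Section convex_hull_zero.
Context {R : realType} {n : nat}.
Implicit Types (K C : set 'rV[R]_n) (u v w : 'rV[R]_n).

Lemma dot_suml m (l : 'I_m -> R) (v : 'I_m -> 'rV[R]_n) u :
  dot (\sum_i l i *: v i) u = \sum_i l i * dot (v i) u.
Proof.
elim: m l v => [|m IH] l v; first by rewrite !big_ord0 dot0l.
by rewrite !big_ord_recl dotDl dotZl IH.
Qed.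

Lemma dot_ge0 u : 0 <= dot u u.
Proof. by apply: sumr_ge0 => i _; rewrite -expr2 sqr_ge0. Qed.

Lemma dot_eq0 u : dot u u = 0 -> u = 0.
Proof.
move=> /eqP; rewrite psumr_eq0; last by move=> i _; rewrite -expr2 sqr_ge0.
move=> /allP u0; apply/rowP => i; rewrite mxE.
by have := u0 i (mem_index_enum _); rewrite /= mulf_eq0 orbb => /eqP.
Qed.

Lemma convex_setP C : @convex_set R 'rV[R]_n C -> forall u v (t : R),
  C u -> C v -> 0 <= t -> t <= 1 -> C (t *: u + (1 - t) *: v).
Proof.
move=> cC u v t Cu Cv t0 t1.
have t01 : Itv.spec (@Itv.num_sem R) (Itv.Real `[0%Z, 1%Z]) t.
  by rewrite /= /Itv.num_sem/= num_real/= in_itv/= t0 t1.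
by have := cC u v (Itv.mk t01) (mem_set Cu) (mem_set Cv); rewrite inE.
Qed.

Lemma convex_sum C m (l : 'I_m -> R) (v : 'I_m -> 'rV[R]_n) :
  @convex_set R 'rV[R]_n C -> (forall i, C (v i)) -> (forall i, 0 <= l i) ->
  \sum_i l i = 1 -> C (\sum_i l i *: v i).
Proof.
move=> cC; elim: m l v => [|m IH] l v Cv l0.
  by rewrite big_ord0 => /esym/eqP; rewrite oner_eq0.
rewrite !big_ord_recl => l1.
have s0 : 0 <= \sum_(i < m) l (lift ord0 i) by exact: sumr_ge0.
have sE : \sum_(i < m) l (lift ord0 i) = 1 - l ord0 by rewrite -l1 addrAC subrr add0r.
have [lz|lz] := eqVneq (l ord0) 1.
  have z i : l (lift ord0 i) = 0.
    apply: le_anti; rewrite l0 andbT.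
    have : \sum_(i < m) l (lift ord0 i) = 0 by rewrite sE lz subrr.
    by move=> /eqP; rewrite psumr_eq0// => /allP/(_ i (mem_index_enum _))/eqP ->.
  by rewrite lz scale1r big1 ?addr0// => i _; rewrite z scale0r.
have d0 : 1 - l ord0 != 0 by rewrite subr_eq0 eq_sym.
have dp : 0 < 1 - l ord0 by rewrite lt_neqAle eq_sym d0 -sE.
rewrite (_ : \sum_(i < m) _ = (1 - l ord0) *:
    \sum_(i < m) (l (lift ord0 i) / (1 - l ord0)) *: v (lift ord0 i)).
  apply: convex_setP => //; last by rewrite -subr_ge0 ltW.
  apply: IH => [//|i|]; first by rewrite divr_ge0// ltW.
  by rewrite -mulr_suml sE divff.
by rewrite scaler_sumr; apply: eq_bigr => i _; rewrite scalerA mulrC divfK.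
Qed.

(** Fixing the number of points makes this, for compact [K], the continuous image of a simplex times
    [K^m], hence compact. *)
Definition combs K m : set 'rV[R]_n := [set w | exists (l : 'I_m -> R) (v : 'I_m -> 'rV[R]_n),
  [/\ forall i, 0 <= l i, \sum_i l i = 1, forall i, K (v i) & w = \sum_i l i *: v i]].

Lemma combs_hull K m : combs K m `<=` convex_hull K.
Proof.
move=> w [l [v [l0 l1 Kv ->]]] C [cC KC].
by apply: convex_sum => // i; exact: KC.
Qed.

Lemma continuous_combination (T : topologicalType) m (l : 'I_m -> T -> R)
  (v : 'I_m -> T -> 'rV[R]_n) : (forall i, continuous (l i)) ->
  (forall i, continuous (v i)) -> continuous (fun p => \sum_i l i p *: v i p).
Proof.
move=> cl cv p; elim: (index_enum _) => [|i s IH].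
  by under eq_fun do rewrite big_nil; exact: cvg_cst.
under eq_fun do rewrite big_cons.
by apply: cvgD IH; apply: cvgZ; [exact: cl|exact: cv].
Qed.

Lemma continuous_dot (T : topologicalType) (u v : T -> 'rV[R]_n) :
  continuous u -> continuous v -> continuous (fun p => dot (u p) (v p)).
Proof.
move=> cu cv p.
have cc (w : T -> 'rV[R]_n) i : continuous w -> {for p, continuous (fun q => w q ord0 i)}.
  move=> cw; apply: (@continuous_comp _ _ _ w (fun x : 'rV[R]_n => x ord0 i) p).
    exact: cw.
  exact: coord_continuous.
rewrite /dot; elim: (index_enum _) => [|i s IH].
  by under eq_fun do rewrite big_nil; exact: cst_continuous.
under eq_fun do rewrite big_cons.
by apply: cvgD IH; apply: cvgM; exact: cc.
Qed.

Lemma compact_combs K m : compact K -> compact (combs K m).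
Proof.
move=> cK.
pose one : 'rV[R]_m := const_mx 1.
have oneE l : dot one l = \sum_i l ord0 i by apply: eq_bigr => i _; rewrite mxE mul1r.
pose D := [set l : 'rV[R]_m | forall i, (`[0%R, 1%R]%classic : set R) (l ord0 i)] `&`
  dot one @^-1` [set x | x = 1].
have cD : compact D.
  apply: compact_closedI.
    by apply: (@rV_compact R m (fun=> `[0%R, 1%R]%classic)) => i; exact: segment_compact.
  by apply: (preimage_closed _ (@closed_eq R _)) => l _; exact: dot_continuous.
pose V := [set v : prod_topology (fun _ : 'I_m => 'rV[R]_n) | forall i, K (v i)].
have cV : compact V by exact: (@tychonoff 'I_m (fun=> 'rV[R]_n) (fun=> K) (fun=> cK)).
pose F (p : 'rV[R]_m * prod_topology (fun _ : 'I_m => 'rV[R]_n)) : 'rV[R]_n :=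
  \sum_i p.1 ord0 i *: p.2 i.
rewrite (_ : combs K m = F @` (D `*` V)).
  apply: continuous_compact; last exact: compact_setX.
  apply: continuous_subspaceT; apply: continuous_combination => i p.
    apply: (@continuous_comp _ _ _ fst (fun u : 'rV[R]_m => u ord0 i) p); last exact: coord_continuous.
    by case: p => p1 p2; exact: cvg_fst.
  apply: (@continuous_comp _ _ _ snd (fun u : prod_topology (fun _ : 'I_m => 'rV[R]_n) => u i) p).
    by case: p => p1 p2; exact: cvg_snd.
  exact: (@proj_continuous 'I_m (fun=> 'rV[R]_n) i).
apply/seteqP; split.
  move=> w [l [v [l0 l1 Kv ->]]]; exists (\row_i l i, v).
    split; last by [].
    split => [i|] /=; last by rewrite oneE; under eq_bigr do rewrite mxE.
    by rewrite mxE in_itv/= l0 -l1 (bigD1 i)//= lerDl; exact: sumr_ge0.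
  by rewrite /F /=; apply: eq_bigr => i _; rewrite !mxE.
move=> _ [[l v] /= [[lD l1] Vv] <-]; exists (l ord0), v; split => //.
  by move=> i; have := lD i; rewrite /= in_itv/= => /andP[].
by rewrite -oneE.
Qed.

Lemma segment_min u w :
  (forall t, 0 <= t -> t <= 1 ->
     dot w w <= dot ((1 - t) *: w + t *: u) ((1 - t) *: w + t *: u)) ->
  dot w w <= dot u w.
Proof.
move=> wmin; rewrite leNgt; apply/negP => uw.
pose D := dot w w - dot u w; pose E := dot (u - w) (u - w).
have D0 : 0 < D by rewrite subr_gt0.
have E0 : 0 <= E by exact: dot_ge0.
have E1 : 0 < E + 1 by rewrite ltr_wpDl.
(* Along the segment the squared norm changes by [- 2 t D + t^2 E], negative as soon as
   [t (E + 1) <= D]. *)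
pose t := Num.min 1 (D / (E + 1)).
have t0 : 0 < t by rewrite lt_min ltr01 divr_gt0.
have tD : t * (E + 1) <= D by rewrite -ler_pdivlMr// /t ge_min lexx orbT.
have t1 : t <= 1 by rewrite /t ge_min lexx.
have := wmin t (ltW t0) t1.
rewrite (_ : (1 - t) *: w + t *: u = w + t *: (u - w)); last first.
  by apply/rowP => i; rewrite !mxE; ring.
rewrite dotDl !dotDr !dotZl !dotZr -/E (dotC w) dotDl dotNl.
by rewrite /D in tD D0; nra.
Qed.

Lemma linear_dependence (v : 'I_n.+1 -> 'rV[R]_n) :
  exists2 c : 'I_n.+1 -> R, \sum_i c i *: v i = 0 & exists i, c i != 0.
Proof.
pose A : 'M[R]_(n.+1, n) := \matrix_i v i.
have : kermx A != 0.
  rewrite kermx_eq0 -row_leq_rank -ltnNge.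
  by rewrite (leq_ltn_trans (rank_leq_col A)).
move=> /rowV0Pn[c /sub_kermxP cA c0]; exists (c ord0).
  by transitivity (c *m A); rewrite // mulmx_sum_row; apply: eq_bigr => i _; rewrite rowK.
apply/existsP; rewrite -negb_forall; apply: contra c0 => /forallP c0.
by apply/eqP/rowP => i; rewrite mxE; apply/eqP; exact: c0.
Qed.

(** Carathéodory's reduction at the minimal point, freeing a slot into which another point of [K]
    can be mixed without exceeding [n + 1] points. If all weights are positive, minimality forces
    every [v i] onto the hyperplane [dot x w = dot w w]; since [w] is nonzero, a linear relation
    between the [n + 1] vectors then has coefficients of sum 0, and subtracting a multiple of it
    preserves both [w] and the total weight. *)
Lemma min_combs_spare K w : combs K n.+1 w -> w != 0 ->
  (forall u, combs K n.+1 u -> dot w w <= dot u u) ->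
  exists (l : 'I_n.+1 -> R) (v : 'I_n.+1 -> 'rV[R]_n) j,
  [/\ forall i, 0 <= l i, \sum_i l i = 1, forall i, K (v i), w = \sum_i l i *: v i & l j = 0].
Proof.
move=> [l [v [l0 l1 Kv wE]]] w0 wmin.
have [[j lj]|nol] := pselect (exists j, l j = 0); first by exists l, v, j.
have lp i : 0 < l i.
  by rewrite lt_neqAle l0 andbT eq_sym; apply/eqP => li; apply: nol; exists i.
have vw i : dot w w <= dot (v i) w.
  apply: segment_min => t t0 t1; apply: wmin.
  exists (fun k => (1 - t) * l k + t * (k == i)%:R), v; split => //.
  - by move=> k; rewrite addr_ge0// mulr_ge0// subr_ge0.
  - rewrite big_split/= -!mulr_sumr l1 (bigD1 i)//= eqxx big1 ?addr0 ?mulr1 ?subrK//.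
    by move=> k ki; rewrite (negbTE ki).
  - rewrite {1}wE scaler_sumr [t *: v i](_ : _ = \sum_k (t * (k == i)%:R) *: v k).
      by rewrite -big_split; apply: eq_bigr => k _ /=; rewrite [RHS]scalerDl scalerA.
    rewrite (bigD1 i)//= eqxx mulr1 big1 ?addr0// => k ki.
    by rewrite (negbTE ki) mulr0 scale0r.
have vwE i : dot (v i) w = dot w w.
  have : \sum_i l i * (dot (v i) w - dot w w) = 0.
    under eq_bigr do rewrite mulrBr.
    by rewrite sumrB -mulr_suml l1 mul1r -dot_suml -wE subrr.
  move=> /eqP; rewrite psumr_eq0 => [/allP/(_ i (mem_index_enum _))|k _].
    by rewrite /= mulf_eq0 gt_eqF//= subr_eq0 => /eqP.
  by rewrite mulr_ge0// subr_ge0.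
have ww0 : dot w w != 0 by apply: contra w0 => /eqP/dot_eq0 ->.
have [c cv [i0 ci0]] := linear_dependence v.
have c1 : \sum_i c i = 0.
  have : (\sum_i c i) * dot w w = 0.
    rewrite mulr_suml -[RHS](dot0l w) -cv dot_suml.
    by apply: eq_bigr => i _; rewrite vwE.
  by move=> /eqP; rewrite mulf_eq0 (negbTE ww0) orbF => /eqP.
have [i1 ci1] : exists i, 0 < c i.
  apply: contrapT => nc; move/eqP: ci0; apply.
  have cn i : c i <= 0 by rewrite leNgt; apply/negP => ci; apply: nc; exists i.
  have : \sum_i - c i = 0 by rewrite sumrN c1 oppr0.
  move=> /eqP; rewrite psumr_eq0 => [/allP/(_ i0 (mem_index_enum _))|k _].
    by rewrite oppr_eq0 => /eqP.
  by rewrite oppr_ge0.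
(* The smallest ratio is the first at which a weight reaches 0 while the others remain
   nonnegative. *)
pose j := [arg min_(i < i1 | 0 < c i) (l i / c i)]%O.
have [cj jmin] : 0 < c j /\ forall i, 0 < c i -> l j / c j <= l i / c i.
  by rewrite /j; case: arg_minP.
exists (fun i => l i - l j / c j * c i), v, j; split => //.
- move=> i; rewrite subr_ge0; have [ci|ci] := ltP 0 (c i).
    by rewrite -ler_pdivlMr// jmin.
  by apply: le_trans (l0 i); rewrite mulr_ge0_le0// divr_ge0// ltW.
- by rewrite sumrB l1 -mulr_sumr c1 mulr0 subr0.
- rewrite wE; under [RHS]eq_bigr do rewrite scalerBl -scalerA.
  by rewrite sumrB -scaler_sumr cv scaler0 subr0.
- by rewrite divfK ?gt_eqF// subrr.
Qed.

(** The norm is minimised over combinations of [n + 1] points, whose compactness is at hand; the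
    spare slot replaces the convexity that a fixed number of points does not give directly. *)
Lemma zero_in_convex_hull K : compact K -> K !=set0 ->
  (forall g, g != 0 -> exists2 v, K v & 0 <= dot v g) -> convex_hull K 0.
Proof.
move=> cK [x Kx] Kg.
have [w] : exists2 w, w \in combs K n.+1 & forall u, u \in combs K n.+1 -> dot w w <= dot u u.
  apply: compact_EVT_min.
  - exists x, (fun i => (i == ord0)%:R), (fun=> x); split => //.
      by rewrite (bigD1 ord0)//= ?eqxx big1 ?addr0// => i /negbTE ->.
    rewrite (bigD1 ord0)//= ?eqxx scale1r big1 ?addr0// => i /negbTE ->.
    by rewrite scale0r.
  - exact: compact_combs.
  - by apply: continuous_subspaceT; apply: (continuous_dot (u := id) (v := id)) => u; exact: cvg_id.
rewrite inE => Cw wmin'; have {}wmin' u : combs K n.+1 u -> dot w w <= dot u u.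
  by move=> Cu; apply: wmin'; rewrite inE.
have [w0|w0] := eqVneq w 0; first by rewrite -w0; exact: combs_hull Cw.
have [l [v [j [l0 l1 Kv wE lj]]]] := min_combs_spare Cw w0 wmin'.
have [u Ku uw] := Kg (- w) ltac:(by rewrite oppr_eq0).
have : dot w w <= dot u w.
  apply: segment_min => t t0 t1; apply: wmin'.
  (* The point [u] takes slot [j], whose weight in [w] is 0. *)
  exists (fun k => (1 - t) * l k + t * (k == j)%:R), (fun k => if k == j then u else v k).
  split.
  - by move=> k; rewrite addr_ge0// mulr_ge0// subr_ge0.
  - rewrite big_split/= -!mulr_sumr l1 (bigD1 j)//= eqxx big1 ?addr0 ?mulr1 ?subrK//.
    by move=> k kj; rewrite (negbTE kj).
  - by move=> k; case: ifP.
  - rewrite (bigD1 j)//= eqxx lj mulr0 add0r mulr1 addrC; congr (_ + _).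
    rewrite wE (bigD1 j)//= lj scale0r add0r scaler_sumr; apply: eq_bigr => k kj.
    by rewrite (negbTE kj) mulr0 addr0 scalerA.
rewrite dotNr oppr_ge0 in uw => wu.
have := dot_ge0 w; move: (le_trans wu uw) => w1 w2.
by case/eqP: w0; apply: dot_eq0; apply/le_anti; rewrite w1.
Qed.

End convex_hull_zero.

(** * Clusters of averages *)

Lemma cluster_le0 {R : realType} (T : topologicalType) (F : set_system T) (p : T)
    (phi : T -> R) : Filter F -> cluster F p -> {for p, continuous phi} ->
  (forall e, 0 < e -> \forall x \near F, phi x <= e) -> phi p <= 0.
Proof.
move=> FF Fp cphi phie; rewrite leNgt; apply/negP => pp.
have e0 : 0 < phi p / 2 by rewrite divr_gt0.
have : nbhs p [set x | phi p / 2 < phi x].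
  by apply: cvgr_gt cphi _ _; rewrite ltr_pdivrMr// ltr_pMr// ltr1n.
by move=> /(Fp _ _ (phie _ e0))[x [/= xle /(le_lt_trans xle)]]; rewrite ltxx.
Qed.

Lemma compact_ball0 {R : realType} n (c : R) : compact [set v : 'rV[R]_n | `|v| <= c].
Proof.
apply: bounded_closed_compact.
  by exists c; split; [exact: num_real|move=> M cM v /= vc]; exact: le_trans vc (ltW cM).
have nc : continuous (fun v : 'rV[R]_n => `|v|).
  apply: (@lipschitz_continuous _ _ _ _ 1) => u v; rewrite mul1r; exact: ler_dist_dist.
by apply: (preimage_closed _ (@closed_le R c)) => v _; exact: nc.
Qed.

Section cluster_set.
Context {R : realType} {n : nat} (f : 'rV[R]_n -> R) (L : R).
Hypothesis fL : forall x y, `|f x - f y| <= L * `|x - y|.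
Variables (x0 y : 'rV[R]_n).
Notation mu := (@lebesgue_measure R).
Notation rV := 'rV[R]_n.
Notation scale m := (m.+1%:R^-1 : R).
Notation vec q := (map_mx ratr q : 'rV[R]_n).

Hypothesis y_generic : forall (q q' : 'rV[rat]_n) (l : nat), {ae mu, forall t : R, 0 < t ->
  differentiable f (x0 + bend (vec q) (vec q') (scale l) t + t ^+ 2 *: y)}.

Definition avg (q : 'rV[rat]_n) (m : nat) : rV :=
  (scale m)^-1 *: gradient_integral f (curve x0 (vec q) (quad y)) (scale m).

Definition tail_avgs (M : nat) : set (rV * rV) :=
  [set p | exists q m, (M <= m)%N /\ p = (avg q m, vec q)].

(** Directions are kept beside the averages so that [|g| = 1] can be imposed in the limit; the
    rational directions themselves need not be unit vectors. *)
Definition cluster_pairs : set (rV * rV) :=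
  [set p | dot p.2 p.2 = 1] `&` \bigcap_(M in [set: nat]) closure (tail_avgs M).

Lemma scale_gt0 m : 0 < scale m.
Proof. by rewrite invr_gt0. Qed.

Lemma avg_bound q m : `|avg q m| <= `|L|.
Proof.
rewrite normrZ normfV gtr0_norm ?scale_gt0// ler_pdivrMl ?scale_gt0//.
apply: norm_row_le => [|i]; first by rewrite mulr_ge0// ltW// scale_gt0.
rewrite mxE mulrC; apply: (@Rintegral_bound _ _ _ (scale m)) => //.
  by apply: (integrable_gradient fL); apply: measurable_curve; exact: measurable_quad.
by move=> t _; rewrite (le_trans (gradient_bound fL _ _))// ler_norm.
Qed.

Lemma tail_avgs_near M v g : closure (tail_avgs M) (v, g) -> forall e, 0 < e ->
  exists q m, [/\ (M <= m)%N, `|avg q m - v| < e & `|vec q - g| < e].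
Proof.
move=> Fvg e e0; have [_ [[q [m [Mm ->]]] []]] := Fvg _ (nbhsx_ballx (v, g) e e0).
by rewrite -!ball_normE /= !(distrC v) !(distrC g) => h1 h2; exists q, m.
Qed.

Lemma compact_cluster_pairs : compact cluster_pairs.
Proof.
pose B c := [set v : rV | `|v| <= c].
have cB : compact (B `|L| `*` B 1) by apply: compact_setX; exact: compact_ball0.
apply: (subclosed_compact _ cB).
  apply: closedI; last by apply: closed_bigI => M _; exact: closed_closure.
  apply: (preimage_closed _ (@closed_eq R 1)) => p _.
  by apply: (continuous_dot (u := snd) (v := snd)) => -[p1 p2]; exact: cvg_snd.
move=> [v g] [/= gg Fvg]; split => /=.
  apply/ler_addgt0Pr => e e0.
  have [q [m [_ h _]]] := tail_avgs_near (Fvg 0%N I) e0.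
  rewrite -[v](subrK (avg q m)) addrC (le_trans (ler_normD _ _))// lerD ?avg_bound//.
  by rewrite distrC ltW.
apply: norm_row_le => // i.
rewrite -(@ler_pXn2r _ 2)// ?nnegrE// real_normK ?num_real// expr1n -gg /dot (bigD1 i)//=.
by rewrite expr2 lerDl; apply: sumr_ge0 => j _; rewrite -expr2 sqr_ge0.
Qed.

Definition cluster_grads : set rV := fst @` cluster_pairs.

Lemma compact_cluster_grads : compact cluster_grads.
Proof.
apply: continuous_compact; last exact: compact_cluster_pairs.
by apply: continuous_subspaceT => -[p1 p2]; exact: cvg_fst.
Qed.

Lemma cluster_grads_Ef : cluster_grads `<=` Ef f x0.
Proof.
move=> _ [[v g] [/= gg Fvg] <-].
have g1 : enorm g = 1.
  rewrite /enorm (eq_bigr (fun i => g ord0 i * g ord0 i)) => [|i _]; last exact: expr2.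
  by rewrite -[X in Num.sqrt X]/(dot g g) gg sqrtr1.
have /choice[S SP] : forall kM : nat * nat, exists qm : 'rV[rat]_n * nat,
    [/\ (kM.2 <= qm.2)%N, `|avg qm.1 qm.2 - v| < scale kM.1 & `|vec qm.1 - g| < scale kM.1].
  move=> [k M]; have [q [m h]] := tail_avgs_near (Fvg M I) (scale_gt0 k).
  by exists (q, m).
(* The lower bound on the next index is the one that gives [a k.+1 <= b k / 2]. *)
pose s := fix s k := if k is j.+1 then S (k, (2 * (s j).2.+1 * j.+1)%N) else S (0%N, 0%N).
pose a k : R := scale (s k).2.
(* Chosen so that [b k] is exactly [a k / (k + 1)] and still the inverse of an integer, one of the
   scales for which [y] is generic. *)
pose l k := ((s k).2.+1 * k.+1).-1.
pose b k : R := scale (l k).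
have lS k : (l k).+1 = ((s k).2.+1 * k.+1)%N by rewrite /l prednK// muln_gt0.
have bE k : b k = a k / k.+1%:R by rewrite /b lS natrM invfM.
have sk k : `|avg (s k).1 (s k).2 - v| < scale k /\ `|vec (s k).1 - g| < scale k.
  case: k => [|k] /=; first by have [_ ? ?] := SP (0%N, 0%N).
  by have [_ ? ?] := SP (k.+1, (2 * (s k).2.+1 * k.+1)%N).
have sM k : (2 * (s k).2.+1 * k.+1 <= (s k.+1).2)%N.
  by rewrite /=; have [] := SP (k.+1, (2 * (s k).2.+1 * k.+1)%N).
have b0 k : 0 < b k by exact: scale_gt0.
have ba k : b k <= a k.
  by rewrite bE ler_pdivrMr// ler_peMr ?ler1n// ltW// scale_gt0.
have ab k : a k.+1 <= b k / 2.
  rewrite /a /b lS -invfM lef_pV2 ?posrE ?mulr_gt0 ?ltr0n ?muln_gt0// -natrM ler_nat.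
  by rewrite (leq_trans _ (leqW (sM k)))// mulnC mulnA.
have ainv k : a k <= scale k.
  rewrite lef_pV2 ?posrE// ler_nat ltnS; elim: k => // k IH.
  apply: leq_trans (sM k); apply: leq_ltn_trans IH _.
  by rewrite -mulnA mulnCA -{1}[(s k).2.+1]muln1 leq_mul.
have hg : vec (s k).1 @[k --> \oo] --> g.
  apply/cvgrPdist_lt => e e0; near=> k.
  rewrite distrC (lt_trans (sk k).2)//; near: k.
  exact: near_infty_natSinv_lt (PosNum e0).
apply: (patch_Ef fL b0 ba ab ainv hg g1 (fun k => y_generic (s k).1 (s k.+1).1 (l k))).
  by move=> k; rewrite bE.
apply/cvgrPdist_lt => e e0; near=> k.
rewrite distrC; apply: (lt_trans (sk k).1); near: k.
exact: near_infty_natSinv_lt (PosNum e0).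
Unshelve. all: by end_near. Qed.

Lemma rat_row_near (g : rV) e : 0 < e -> exists q : 'rV[rat]_n, `|vec q - g| <= e.
Proof.
move=> e0.
have /choice[r rP] (i : 'I_n) : exists r : rat, `|ratr r - g ord0 i| <= e.
  have [r] := @rat_in_itvoo R (g ord0 i - e) (g ord0 i + e) ltac:(lra).
  by rewrite in_itv/= => rP; exists r; rewrite ler_distl; lra.
exists (\row_i r i); apply: norm_row_le => [|i]; first exact: ltW.
by rewrite !mxE.
Qed.

(** A straight curve is a bend between equal directions, so the genericity of [y] covers it too. *)
Lemma curve_quadE q (t : R) :
  curve x0 (vec q) (quad y) t = x0 + bend (vec q) (vec q) 1 t + t ^+ 2 *: y.
Proof. by rewrite /curve /bend subrr scaler0 addr0. Qed.

(** The sign [sg] is 1 at a minimum and -1 at a maximum; the increment of [f] then has a favourable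
    sign and only the error of [average_gradient] remains. *)
Lemma avg_dot q m (sg : R) : sg * sg = 1 -> (forall x, 0 <= sg * (f x - f x0)) ->
  - (sg * dot (avg q m) (vec q)) <= n%:R * `|L| * (2 * scale m * `|y|).
Proof.
move=> sg1 sgf.
have dq : {ae mu, forall t : R, 0 < t -> differentiable f (curve x0 (vec q) (quad y) t)}.
  apply: filterS (y_generic q q 0); first exact: (ae_filter_ringOfSetsType mu).
  by move=> t h t0; rewrite curve_quadE; have := h t0; rewrite invr1.
have s1 : scale m <= 1 by rewrite invf_le1// ler1n.
have := average_gradient fL dq (scale_gt0 m) s1.
rewrite -/(avg q m).
set A := dot _ _; set D := f _ - f x0 => AD.
have sD : 0 <= sg * ((scale m)^-1 * D).
  by rewrite mulrCA mulr_ge0 ?invrK// sgf.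
have nsg : `|sg| = 1.
  by apply/eqP; rewrite -(@eqrXn2 _ 2)// expr1n real_normK ?num_real// expr2 sg1.
set X := (scale m)^-1 * D in AD sD *.
have /ler_normlP[h _] : `|sg * (A - X)| <= n%:R * `|L| * (2 * scale m * `|y|).
  by rewrite normrM nsg mul1r.
by apply: le_trans h; rewrite mulrBr opprB lerDr.
Qed.

Lemma cluster_grads_support (sg : R) g : sg * sg = 1 ->
  (forall x, 0 <= sg * (f x - f x0)) -> g != 0 ->
  exists2 v, cluster_grads v & 0 <= dot v g.
Proof.
move=> sg1 sgf g0.
have gg0 : 0 < dot g g.
  by rewrite lt_neqAle dot_ge0 andbT eq_sym; apply: contra g0 => /eqP/dot_eq0 ->.
pose c := Num.sqrt (dot g g); have c0 : 0 < c by rewrite sqrtr_gt0.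
(* At a maximum the averages are taken in the direction opposite to [g]; the two signs cancel at the
   end. *)
pose u := (sg / c) *: g.
have uu : dot u u = 1.
  rewrite /u dotZl dotZr mulrA -expr2 expr_div_n expr2 sg1 sqr_sqrtr ?dot_ge0//.
  by rewrite mul1r mulVf// gt_eqF.
have /choice[q qP] m : exists q : 'rV[rat]_n, `|vec q - u| <= scale m.
  by apply: rat_row_near; exact: scale_gt0.
pose p m : rV * rV := (avg (q m) m, vec (q m)).
pose F := p @ \oo.
have FF : ProperFilter F by exact: fmap_proper_filter.
have cB : compact ([set v : rV | `|v| <= `|L|] `*` [set v : rV | `|v| <= `|u| + 1]).
  by apply: compact_setX; exact: compact_ball0.
have [|[v w] [_ Fvw]] := cB F FF.
  apply: (@filterE _ \oo) => m; split; first exact: avg_bound.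
  rewrite /= -[vec _](subrK u) addrC (le_trans (ler_normD _ _))// lerD//.
  by rewrite (le_trans (qP m))// invf_le1// ler1n.
have scale_near e : 0 < e -> \forall m \near \oo, scale m <= e.
  move=> e0; near=> m; apply/ltW; near: m.
  exact: near_infty_natSinv_lt (PosNum e0).
have wu : w = u.
  apply/eqP; rewrite -subr_eq0 -normr_le0.
  apply: (cluster_le0 (phi := fun z : rV * rV => `|z.2 - u|) _ Fvw).
    by apply: (@cvg_norm _ _ _ _ (nbhs_filter _)); apply: cvgB; [exact: cvg_snd|exact: cvg_cst].
  move=> e e0; apply: filterS (scale_near e e0) => m; apply: le_trans; exact: qP.
have sdot : 0 <= sg * dot v w.
  rewrite -oppr_le0.
  apply: (cluster_le0 (phi := fun z : rV * rV => - (sg * dot z.1 z.2)) _ Fvw).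
    apply: cvgN; apply: cvgM; first exact: cvg_cst.
    apply: (continuous_dot (u := fst) (v := snd)).
      by move=> [z1 z2]; exact: cvg_fst.
    by move=> [z1 z2]; exact: cvg_snd.
  move=> e e0; pose C := n%:R * `|L| * (2 * `|y|).
  have C0 : 0 < C + 1 by rewrite ltr_wpDl// !mulr_ge0.
  apply: filterS (scale_near (e / (C + 1)) (divr_gt0 e0 C0)) => m.
  rewrite ler_pdivlMr// => me; apply: (le_trans (avg_dot _ _ sg1 sgf)).
  apply: (le_trans _ me); rewrite mulrDr mulr1 ler_wpDr ?(ltW (scale_gt0 m))//.
  by rewrite /C le_eqVlt; apply/orP; left; apply/eqP; ring.
exists v.
  exists (v, w) => //; split; first by rewrite /= wu.
  move=> M _ B; apply: Fvw; apply: filterS (nbhs_infty_ge M) => m Mm.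
  by exists (q m), m.
move: sdot; rewrite wu /u dotZr !mulrA sg1 mul1r mulrC.
by rewrite pmulr_lge0// invr_gt0.
Unshelve. all: by end_near. Qed.

End cluster_set.

Theorem corollary4p2 (R : realType) (n : nat) (hn : (0 < n)%N)
    (f : 'rV[R]_n -> R) (hf : lipschitz_function f)
    (xs : 'rV[R]_n) (hxs : optimal_point f xs) :
  Df f xs 0.
Proof.
have [L Lf] := hf; pose M := `|L| * n%:R.
have fL x y : `|f x - f y| <= M * `|x - y|.
  apply: (le_trans (Lf x y)); rewrite -mulrA.
  apply: (@le_trans _ _ (`|L| * enorm (x - y))).
    by rewrite ler_wpM2r ?ler_norm// sqrtr_ge0.
  by rewrite ler_wpM2l// enorm_le.
(* All possible pieces: two rational directions and a turning scale. *)
pose c (i : 'rV[rat]_n * 'rV[rat]_n * nat) (t : R) : 'rV[R]_n :=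
  xs + bend (map_mx ratr i.1.1) (map_mx ratr i.1.2) i.2.+1%:R^-1 t.
have mc i : measurable_row (c i).
  move=> k; rewrite (_ : (fun t => _) = fun t : R => xs ord0 k +
      (t * ratr (i.1.1 ord0 k) + (ramp i.2.+1%:R^-1 t - t) *
        (ratr (i.1.1 ord0 k) - ratr (i.1.2 ord0 k)))).
    apply: measurable_funD => //; apply: measurable_funD.
      by apply: measurable_funM.
    apply: measurable_funM => //; apply: measurable_funB => //.
    exact: measurable_ramp.
  by apply/funext => t; rewrite /c /bend !mxE.
have [y yP] := generic_curves fL mc.
have y_generic q q' l := yP (q, q', l).
have [sg sg1 sgf] : exists2 s : R, s * s = 1 & forall x, 0 <= s * (f x - f xs).
  case: hxs => fxs; [exists 1|exists (-1)]; rewrite ?mulrNN ?mulr1// => x.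
    by rewrite mul1r subr_ge0.
  by rewrite mulN1r opprB subr_ge0.
have : convex_hull (cluster_grads f xs y) 0.
  have support (g : 'rV[R]_n) : g != 0 -> exists2 v, cluster_grads f xs y v & 0 <= dot v g.
    exact: (cluster_grads_support fL y_generic sg1 sgf).
  apply: (zero_in_convex_hull _ _ support); first exact: (compact_cluster_grads fL).
  (* The cluster set is nonempty because [n > 0] provides a nonzero direction. *)
  have [|v Kv _] := support (delta_mx ord0 (Ordinal hn)); last by exists v.
  by rewrite -normr_gt0 norm_delta.
move=> h A [cA EA]; apply: h; split=> // v Kv.
by apply: EA; exact: (cluster_grads_Ef fL y_generic Kv).
Qed.
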